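(* Let $n\ge 1$ and let $P$ be a positive definite Hermitian $(n+1)\times(n+1)$ matrix. Then the Chebyshev potential of the Fubini--Study potential $\varphi_P$ on the hyperplane bundle $H\to\mathbb{P}^n$, with respect to the flag $Y_\bullet$ and the chart/trivialization described in the context, is given for every $\alpha=(\alpha_0,\ldots,\alpha_{n-1})$ in the interior of the simplex $\Delta=\{\alpha\in\mathbb{R}_{\ge0}^n:\sum_{i=0}^{n-1}\alpha_i\le 1\}$ by $$c[\varphi_P](\alpha)=\sum_{i=0}^{n-1}\alpha_i\log\frac{\alpha_i}{\mu_i(P)}+\Big(1-\sum_{i=0}^{n-1}\alpha_i\Big)\log\frac{1-\sum_{i=0}^{n-1}\alpha_i}{\mu_n(P)}.$$
   Context: Setup on $\mathbb{P}^n$: $[Z_0:\cdots:Z_n]$ are homogeneous coordinates, $H=\mathcal{O}(1)$ the hyperplane bundle, $mH=H^{\otimes m}$. On $U_n=\{Z_n\ne0\}$ use affine coordinates $z_i=Z_i/Z_n$ ($0\le i\le n-1$) and the trivialization of $H$ over $U_n$ in which the section $Z_i$ corresponds to the function $z_i$ (and $Z_n$ to $1$); thus sections of $mH$ are identified with polynomials in $z_0,\ldots,z_{n-1}$ of degree $\le m$. The flag is $Y_i=V(Z_0,\ldots,Z_{i-1})$, $i=0,\ldots,n$, so $Y_n=\{[0:\cdots:0:1]\}$; its Okounkov body is the simplex $\Delta$ above. For a positive definite Hermitian $(n+1)\times(n+1)$ matrix $P$, the Fubini--Study potential is $\varphi_P=\log(z^*Pz)$ with $z=(z_0,\ldots,z_{n-1},1)^{\mathsf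 T}$; it is the local weight of the metric on $H$ for which a section $s$ of $mH$ given by a homogeneous polynomial $f$ of degree $m$ has $|s|^2=|f(Z)|^2/(Z^*PZ)^m$. Chebyshev potential: order $\mathbb{N}^n$ lexicographically ($\alpha<\beta$ iff $\alpha_i<\beta_i$ at the first index $i$ where they differ). For a nonzero section $s=\sum_\alpha k_\alpha z^\alpha$ of $mH$ let $\nu(s)=\min\{\alpha: k_\alpha\neq0\}$ and its leading term $\ell(s)=k_{\nu(s)}z^{\nu(s)}$. Let $\Delta_m=\{\nu(s): 0\ne s\in H^0(\mathbb{P}^n,mH)\}$ (here $\Delta_m=\{\alpha\in\mathbb{N}^n:\sum\alpha_i\le m\}$). For $\alpha\in\frac1m\Delta_m$ set $A_{m,\alpha}=\{s\in H^0(mH):\ell(s)=z^{m\alpha}\}$. Given a continuous weight $\varphi$ and a smooth volume form $\mu$, equip $H^0(mH)$ with the inner product $\langle s,t\rangle=\int s\bar t\,e^{-m\varphi}d\mu$; the Chebyshev section $Ch_{m,\alpha}$ is the unique minimizer of the norm on $A_{m,\alpha}$. For $\alpha$ in the interior of $\Delta$, $c[\varphi](\alpha)=\lim_{k\to\infty}\frac{1}{m_k}\log\|Ch_{m_k,\alpha_k}\|^2$, where $m_k$ is strictly increasing and $\alpha_k\in\frac{1}{m_k}\Delta_{m_k}$, $\alpha_k\to\alpha$; this limit exists and is independent of the choices of $(m_k,\alpha_k)$ and of $\mu$. For a positive definite Hermitian $P=(p_{jk})_{0\le j,k\le n}$ let $\det_i(P)=\det(p_{jk})_{i\le j,k\le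 n}$ for $0\le i\le n$, $\det_{n+1}(P)=1$, and $\mu_i(P)=\det_i(P)/\det_{i+1}(P)$ for $0\le i\le n$. *)

(* Defs.v *)
From HB Require Import structures.
From mathcomp Require Import all_boot all_order all_algebra.
From mathcomp Require Import complex.
From mathcomp Require Import all_classical all_reals all_analysis.

Set Implicit Arguments.
Unset Strict Implicit.
Unset Printing Implicit Defensive.

Import Order.TTheory GRing.Theory Num.Theory.
Local Open Scope ring_scope.

Section FS.
Variable R : realType.
Local Notation C := (complex R).

Definition sqmod (w : C) : R := (@complex.Re R w) ^+ 2 + (@complex.Im R w) ^+ 2.

Definition conjT (k l : nat) (A : 'M[C]_(k, l)) : 'M[C]_(l, k) :=
  map_mx (@conjc R) A^T.

Definition hermitian_pd (n : nat) (P : 'M[C]_n.+1) : Prop :=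
  conjT P = P /\
  forall v : 'cV[C]_n.+1, v != 0 -> 0 < @complex.Re R ((conjT v *m P *m v) 0 0).

(* det_i(P) = det (p_jk)_{i <= j,k <= n};  det_{n+1}(P) = det of the empty matrix = 1 *)
Definition det_from (n : nat) (P : 'M[C]_n.+1) (i : nat) : C :=
  \det (\matrix_(j < n.+1 - i, k < n.+1 - i)
          P (inord (i + j)) (inord (i + k))).

(* mu_i(P) = det_i(P) / det_{i+1}(P)  (a positive real number for P pos. def.) *)
Definition mu_ (n : nat) (P : 'M[C]_n.+1) (i : nat) : R :=
  @complex.Re R (det_from P i / det_from P i.+1).

Definition zvec (n : nat) (z : 'I_n -> C) : 'cV[C]_n.+1 :=
  \col_(i < n.+1) (if unlift ord_max i is Some j then z j else 1).

Definition phiFS (n : nat) (P : 'M[C]_n.+1) (z : 'I_n -> C) : R :=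
  ln (@complex.Re R ((conjT (zvec z) *m P *m zvec z) 0 0)).

(* ---------- sections of mH on U_n: polynomials of degree <= m ---------- *)
Definition mindex (n m : nat) := {ffun 'I_n -> 'I_m.+1}.
Definition mdeg (n m : nat) (a : mindex n m) : nat := (\sum_(i < n) (a i : nat))%N.

Definition is_section (n m : nat) (k : {ffun mindex n m -> C}) : Prop :=
  forall a : mindex n m, (m < mdeg a)%N -> k a = 0.

Definition peval (n m : nat) (k : {ffun mindex n m -> C}) (z : 'I_n -> C) : C :=
  \sum_(a : mindex n m) k a * \prod_(i < n) z i ^+ (a i).

Definition lexlt (n m : nat) (a b : mindex n m) : Prop :=
  exists i : 'I_n, (forall j : 'I_n, (j < i)%N -> a j = b j) /\ (a i < b i)%N.

(* A_{m,alpha}: nonzero sections with leading term l(s) = z^beta (beta = m alpha) *)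
Definition A_set (n m : nat) (beta : mindex n m) : set {ffun mindex n m -> C} :=
  [set k | is_section k /\ k beta = 1 /\
           (forall a : mindex n m, lexlt a beta -> k a = 0)].

Fixpoint iint (k : nat) (F : seq C -> \bar R) : \bar R :=
  match k with
  | 0 => F [::]
  | k'.+1 => (\int[@lebesgue_measure R]_x \int[@lebesgue_measure R]_y
                 iint k' (fun s => F ((x +i* y)%C :: s)))%E
  end.

Definition of_seq (n : nat) (s : seq C) : 'I_n -> C := fun i => nth 0 s i.

(* ||s||^2 = \int |s|^2 e^{-m phi} dmu,  with dmu = rho dlambda on the chart *)
Definition L2norm2 (n m : nat) (P : 'M[C]_n.+1) (rho : ('I_n -> C) -> R)
    (k : {ffun mindex n m -> C}) : \bar R :=
  iint n (fun s => (sqmod (peval k (@of_seq n s))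
                   * expR (- (m%:R * phiFS P (@of_seq n s))) * rho (@of_seq n s))%:E).

Definition cheb_norm2 (n m : nat) (P : 'M[C]_n.+1) (rho : ('I_n -> C) -> R)
    (beta : mindex n m) : R :=
  fine (ereal_inf [set L2norm2 P rho k | k in A_set beta]).

(* density of the Fubini--Study volume form in the chart: (1 + |z|^2)^{-(n+1)} *)
Definition fs_density (n : nat) (z : 'I_n -> C) : R :=
  (1 + \sum_(i < n) sqmod (z i)) ^- n.+1.

(* densities rho (w.r.t. Lebesgue measure on the chart C^n) of smooth volume forms
   on P^n: comparable to the Fubini--Study density *)
Definition admissible_density (n : nat) (rho : ('I_n -> C) -> R) : Prop :=
  exists c1 c2 : R, 0 < c1 /\ 0 < c2 /\
    forall z, c1 * fs_density z <= rho z /\ rho z <= c2 * fs_density z.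

End FS.

(* Main.v *)
Require Import Defs.
From HB Require Import structures.
From mathcomp Require Import all_boot all_order all_algebra.
From mathcomp Require Import cyclic separable cyclotomic.
From mathcomp Require Import complex.
From mathcomp Require Import all_classical all_reals all_analysis.
From mathcomp Require Import measurable_realfun ring lra.
Import Order.TTheory GRing.Theory Num.Theory numFieldNormedType.Exports.
Local Open Scope ring_scope.
Local Open Scope classical_set_scope.

Set Implicit Arguments.
Unset Strict Implicit.
Unset Printing Implicit Defensive.

(** Let P = A^* diag(mu) A with A lower unitriangular, put W = A Z, so that
    Q(z) = z^* P z is the sum of the mu_i |W_i|^2, and write h_i = b_i for i < n and
    h_n = m - |b|. Only the exponential growth rate of the minimal norm matters, so it
    is enough to bound that norm up to factors of subexponential growth in m.

    Above: since A is lower unitriangular, the product of the W_i^(h_i) has leading term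
    z^b, and by Gibbs' inequality its squared modulus is at most
    Q^m times the product of the (h_i / (m mu_i))^(h_i).

    Below: put M = m + n + 1. The leading term of a competitor f survives the triangular
    change of coordinates, so the maximum principle gives a point of the torus
    |W_i|^2 = alpha_i / mu_i, on which Q = 1, where the homogenization of f of degree M
    has squared modulus at least the product of the |W_i|^2 to the powers h_i, up to a
    constant. Homogenizing to degree M > m forces Z_n <> 0 there and absorbs the volume
    density, which is comparable to Q^(-(n+1)). Finally Q(z) / Q(z') is at most
    (1 + 1/M) (1 + K M |z - z'|^2), so Cauchy's estimates, applied one variable at a
    time, bound the integral of |f|^2 Q^(-M) from below by its integrand at that point
    divided by a power of M. *)

(** * Cauchy estimates for polynomials *)

Section Cauchy.
Variable F : numClosedFieldType.
Implicit Types (p : {poly F}) (r t z B : F).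

(** In characteristic 0 the polynomial ['X^n - 1] is separable, so it splits with [n] distinct
    roots, and [n] distinct [n]-th roots of unity include a primitive one. *)
Lemma ex_prim_root n : (0 < n)%N -> exists z : F, n.-primitive_root z.
Proof.
move=> n_gt0; have [r Dp] := closed_field_poly_normal ('X^n - 1 : {poly F}).
rewrite (monicP _) ?monicXnsubC // scale1r in Dp.
have rn1 : all n.-unity_root r.
  by apply/allP=> z; rewrite -root_prod_XsubC -Dp.
have sz_r : (n < (size r).+1)%N.
  by rewrite -(size_prod_XsubC r id) -Dp size_XnsubC.
have [|z] := hasP (has_prim_root n_gt0 rn1 _ sz_r); last by exists z.
by rewrite -separable_prod_XsubC -Dp separable_Xn_sub_1 // pnatr_eq0 -lt0n.
Qed.

Lemma sum_expr_prim_root n z k : n.-primitive_root z ->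
  \sum_(j < n) z ^+ (j * k) = if (n %| k)%N then n%:R else 0.
Proof.
move=> zP; have [/dvdnP[d ->]|nk] := ifPn.
  rewrite (eq_bigr (fun=> 1)) ?sumr_const ?card_ord // => j _.
  by rewrite mulnA mulnC exprM (prim_expr_order zP) expr1n.
have zk1 : z ^+ k - 1 != 0 by rewrite subr_eq0 -(prim_order_dvd zP).
apply: (mulfI zk1); rewrite mulr0.
transitivity ((z ^+ k) ^+ n - 1).
  rewrite [RHS]subrX1; congr (_ * _); apply: eq_bigr => j _.
  by rewrite -exprM mulnC.
by rewrite exprAC (prim_expr_order zP) expr1n subrr.
Qed.

(** A discrete form of Cauchy's integral formula: the mean over [n] equally spaced points of the
    circle is exact as soon as [size p <= n]. The exponent [n - k] plays the role of [-k]. *)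
Lemma coef_root_mean n z p k r : n.-primitive_root z -> (size p <= n)%N ->
  (k < n)%N ->
  \sum_(j < n) p.[r * z ^+ j] * z ^+ (j * (n - k)) = n%:R * (p`_k * r ^+ k).
Proof.
move=> zP sp kn.
transitivity (\sum_(j < n) \sum_(l < n) p`_l * r ^+ l * z ^+ (j * (l + (n - k)))).
  apply: eq_bigr => j _; rewrite (horner_coef_wide _ sp) mulr_suml.
  apply: eq_bigr => l _; rewrite exprMn -exprM -!mulrA -exprD.
  by rewrite -mulnDr.
rewrite exchange_big /= (bigD1 (Ordinal kn)) //= [X in _ + X]big1 ?addr0.
  by rewrite -mulr_sumr (sum_expr_prim_root _ zP) subnKC ?(ltnW kn) // dvdnn mulrC.
move=> l lk; rewrite -mulr_sumr (sum_expr_prim_root _ zP).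
case: ifP; last by rewrite mulr0.
move=> H.
(* The exponent is a multiple of [n] lying strictly between 0 and [2 * n]. *)
have E : (l + (n - k))%N = n.
  have l0 : (0 < l + (n - k))%N by rewrite addn_gt0 subn_gt0 kn orbT.
  have l2 : (l + (n - k) < 2 * n)%N.
    by rewrite mul2n -addnn (leq_trans (_ : _ < n + (n - k))%N) ?ltn_add2r// leq_add2l leq_subr.
  case/dvdnP: H l0 l2 => -[|[|d]] ->; rewrite ?mul1n // ltn_mul2r.
  by case: n {zP sp kn l lk} => //.
have lk' : l = k :> nat by rewrite -(addnK (n - k) l) E subKn // ltnW.
by move: lk; rewrite -val_eqE /= lk' eqxx.
Qed.

Lemma cauchy_estimate p k r B : 0 <= r ->
  (forall t, `|t| = r -> `|p.[t]| <= B) -> `|p`_k| * r ^+ k <= B.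
Proof.
move=> r0 pB; pose n := maxn (size p) k.+1.
have n0 : (0 < n)%N by rewrite leq_max orbT.
have [z zP] := ex_prim_root n0.
have z1 : `|z| = 1.
  by apply/eqP; rewrite -(pexpr_eq1 n0) // -normrX (prim_expr_order zP) normr1.
have n0' : 0 < n%:R :> F by rewrite ltr0n.
rewrite -(ler_pM2l n0').
have -> : n%:R * (`|p`_k| * r ^+ k) = `|n%:R * (p`_k * r ^+ k)|.
  by rewrite !normrM normrX (ger0_norm r0) normr_nat.
rewrite -(coef_root_mean _ zP) ?leq_maxl ?leq_maxr //.
apply: le_trans (ler_norm_sum _ _ _) _.
rewrite mulr_natl -[X in _ *+ X]card_ord -sumr_const; apply: ler_sum => j _.
rewrite normrM normrX z1 expr1n mulr1; apply: pB.
by rewrite normrM normrX z1 expr1n mulr1 ger0_norm.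
Qed.

(** The value at 0 is the mean of the values at [r * z ^+ j]; if all of these were smaller in
    modulus, so would be their mean. *)
Lemma max_modulus p r : 0 <= r -> exists2 t, `|t| = r & `|p.[0]| <= `|p.[t]|.
Proof.
move=> r0; pose n := (size p).+1.
have [z zP] := @ex_prim_root n isT.
have z1 : `|z| = 1.
  by apply/eqP; rewrite -(@pexpr_eq1 _ _ n) // -normrX (prim_expr_order zP) normr1.
have [j jP|H] := pickP (fun j : 'I_n => `|p.[0]| <= `|p.[r * z ^+ j]|).
  by exists (r * z ^+ j) => //; rewrite normrM normrX z1 expr1n mulr1 ger0_norm.
have : n%:R * `|p.[0]| < n%:R * `|p.[0]|.
  have {1}-> : n%:R * `|p.[0]| = `|n%:R * (p`_0 * r ^+ 0)|.
    by rewrite !normrM normr1 mulr1 normr_nat horner_coef0.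
  rewrite -(coef_root_mean _ zP) //.
  apply: le_lt_trans (ler_norm_sum _ _ _) _.
  rewrite mulr_natl -[X in _ *+ X]card_ord -sumr_const; apply: ltr_sum.
    by apply/hasP; exists ord0; rewrite ?mem_index_enum.
  move=> j _; rewrite normrM normrX z1 expr1n mulr1 real_ltNge ?normr_real //.
  by rewrite H.
by rewrite ltxx.
Qed.

(* The geometric series with ratio 1/8 gives the constant 1/7. *)
Lemma horner_sub0_le p r B t : 0 <= r ->
  (forall t, `|t| = r -> `|p.[t]| <= B) -> 8 * `|t| <= r ->
  7 * `|p.[t] - p.[0]| <= B.
Proof.
move=> r0 pB tr.
have B0 : 0 <= B by apply: le_trans (normr_ge0 _) (pB r _); exact: ger0_norm.
have sumB n : 7 * \sum_(i < n) B / 8 ^+ i.+1 <= B.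
  suff -> : 7 * \sum_(i < n) B / 8 ^+ i.+1 = B - B / 8 ^+ n.
    by rewrite gerBl divr_ge0 // exprn_ge0.
  elim: n => [|n IH]; first by rewrite big_ord0 mulr0 divr1 subrr.
  rewrite big_ord_recr /= mulrDr IH exprS; field.
  by rewrite expf_neq0// pnatr_eq0.
apply: le_trans (sumB (size p).-1); rewrite ler_pM2l ?ltr0n//.
have -> : p.[t] - p.[0] = \sum_(i < (size p).-1) p`_i.+1 * t ^+ i.+1.
  case E : (size p) => [|n].
    by move/eqP: E; rewrite size_poly_eq0 => /eqP ->; rewrite big_ord0 !horner0 subrr.
  rewrite horner_coef E big_ord_recl /= expr0 mulr1 -horner_coef0 addrC addKr.
  by [].
apply: le_trans (ler_norm_sum _ _ _) _; apply: ler_sum => i _.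
rewrite normrM normrX ler_pdivlMr ?exprn_gt0// -mulrA -exprMn.
rewrite (le_trans _ (cauchy_estimate i.+1 r0 pB))// ler_wpM2l//.
by rewrite lerXn2r ?nnegrE ?mulr_ge0// mulrC.
Qed.
End Cauchy.

(** * Iterated integrals *)

Section Integrals.
Variable R : realType.
Local Notation C := (complex R).
Local Notation mu := (@lebesgue_measure R).
Implicit Types (f g : R -> \bar R) (F G : seq C -> \bar R).

(* Unlike ge0_le_integral, no measurability: an integral of a nonnegative function
   is a supremum over the simple functions below it. *)
Lemma ge0_le_integral_nomeas f g : (forall x, 0 <= f x)%E ->
  (forall x, f x <= g x)%E -> (\int[mu]_x f x <= \int[mu]_x g x)%E.
Proof.
move=> f0 fg; have g0 x : (0 <= g x)%E by exact: le_trans (f0 x) (fg x).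
rewrite !ge0_integralTE//; apply: le_ereal_sup => _ [h hf <-].
by exists h => // x; exact: le_trans (hf x) (fg x).
Qed.

Lemma iint_ge0 k F : (forall s, 0 <= F s)%E -> (0 <= iint k F)%E.
Proof.
elim: k F => [|k IH] F F0 //=.
by apply: integral_ge0 => x _; apply: integral_ge0 => y _; apply: IH.
Qed.

(** The comparison is needed only on lists of length [k], the only ones at which [iint k] evaluates
    its integrand. *)
Lemma le_iint k F G : (forall s, 0 <= F s)%E ->
  (forall s, size s = k -> F s <= G s)%E -> (iint k F <= iint k G)%E.
Proof.
elim: k F G => [|k IH] F G F0 FG /=; first exact: FG.
apply: ge0_le_integral_nomeas => x.
  by apply: integral_ge0 => y _; apply: iint_ge0.
apply: ge0_le_integral_nomeas => y; first exact: iint_ge0.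
by apply: IH => // s sk; apply: FG; rewrite /= sk.
Qed.

Lemma ge_integral_itv f (a b c : R) : a < b -> 0 <= c -> (forall x, 0 <= f x)%E ->
  (forall x, (a <= x <= b)%R -> (c%:E <= f x)%E) ->
  ((c * (b - a))%:E <= \int[mu]_x f x)%E.
Proof.
move=> ab c0 f0 fc; pose h x := (c * \1_`[a, b]%classic x)%:E.
apply: (@le_trans _ _ (\int[mu]_x h x)%E); last first.
  apply: ge0_le_integral_nomeas => x; rewrite /h; first by rewrite lee_fin mulr_ge0.
  rewrite indicE; have [xab|_] := boolP (x \in `[a, b]%classic); last by rewrite mulr0.
  by rewrite mulr1; apply: fc; move: xab; rewrite inE /= in_itv.
under eq_integral do rewrite /h EFinM.
rewrite ge0_integralZl_EFin//; first last.
  by apply/measurable_EFinP; exact: measurable_indic.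
rewrite integral_indic// setIT /=.
by rewrite lebesgue_measure_itv/= lte_fin ab -EFinD -EFinM.
Qed.

Lemma ge_integral2_box (f : R -> R -> \bar R) (a b d c : R) :
  0 < d -> 0 <= c -> (forall x y, 0 <= f x y)%E ->
  (forall x y, (`|x - a| <= d)%R -> (`|y - b| <= d)%R -> (c%:E <= f x y)%E) ->
  ((c * (2 * d) ^+ 2)%:E <= \int[mu]_x \int[mu]_y f x y)%E.
Proof.
move=> d0 c0 f0 fc.
have E t : t + d - (t - d) = 2 * d by ring.
have dd t : t - d < t + d by lra.
have abs x t : t - d <= x <= t + d -> `|x - t| <= d by rewrite ler_distl.
rewrite expr2 mulrA -{2}(E a); apply: (ge_integral_itv (dd a)).
- by rewrite mulr_ge0// mulr_ge0// ltW.
- by move=> x; apply: integral_ge0.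
- move=> x /abs xa; rewrite -(E b).
  by apply: (ge_integral_itv (dd b)) => // y /abs yb; exact: fc.
Qed.

Lemma integral_invr_sqrDl (B : R) : 0 < B ->
  (\int[mu]_x ((B + x ^+ 2)^-1)%:E = (pi / Num.sqrt B)%:E)%E.
Proof.
move=> B0; pose r := Num.sqrt B; have r0 : 0 < r by rewrite sqrtr_gt0.
have rB : r ^+ 2 = B by rewrite sqr_sqrtr// ltW.
have BD (x : R) : 0 < B + x ^+ 2 by rewrite ltr_wpDr// sqr_ge0.
have cf : continuous (fun x : R => (B + x ^+ 2)^-1).
  move=> x; apply: cvgV; first by rewrite gt_eqF.
  by apply: cvgD; [exact: cvg_cst|exact: exprn_continuous].
rewrite (@ge0_symfun_integralT _ (fun x => (B + x ^+ 2)^-1))//; last 2 first.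
- by move=> x; rewrite invr_ge0 ltW.
- by move=> x /=; rewrite sqrrN.
rewrite -set_itvcy.
(* The integrand is even, so half of the line suffices, where [G] is an antiderivative. *)
pose G (x : R) := r^-1 * atan (x / r).
have dG (x : R) : is_derive x 1 G (B + x ^+ 2)^-1.
  rewrite /G; apply: is_derive_eq.
  rewrite /GRing.scale /= -rB -[r]/(Num.sqrt B) -/r.
  have := BD x; rewrite -rB => h; field.
  by rewrite ?gt_eqF //.
have cG : continuous G.
  by move=> x; apply: differentiable_continuous; apply/derivable1_diffP; apply: ex_derive.
have Gy : G x @[x --> +oo] --> r^-1 * (pi / 2).
  apply: cvgM; first exact: cvg_cst.
  apply: (@cvg_comp _ _ _ (fun x => x / r) atan _ (pinfty_nbhs R)); last exact: cvgy_atan.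
  apply: gt0_cvgMly; rewrite ?invr_gt0//; exact: cvg_id.
rewrite (ge0_continuous_FTC2y _ _ Gy)//=.
- rewrite /G mul0r atan0 mulr0 oppr0 adde0 -EFinM; congr EFin.
  rewrite -/r; field; by rewrite gt_eqF.
- by move=> x _; rewrite invr_ge0 ltW.
- exact: continuous_subspaceT.
- by apply: cvg_at_right_filter; exact: cG.
- by move=> x _; rewrite derive1E; exact: derive_val.
Qed.

(** The factor [B ^+ j] is split off, and [(B + x ^+ 2) * (B + y ^+ 2) <= (B + x ^+ 2 + y ^+ 2) ^+
    2] separates the variables; each remaining integral is [pi / Num.sqrt B]. *)
Lemma integral2_invr_le (A B : R) (j : nat) : 0 <= A -> 0 < B ->
  (\int[mu]_x \int[mu]_y (A / (B + x ^+ 2 + y ^+ 2) ^+ j.+2)%:E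
     <= (A * pi ^+ 2 / B ^+ j.+1)%:E)%E.
Proof.
move=> A0 B0; have BD (x : R) : 0 < B + x ^+ 2 by rewrite ltr_wpDr// sqr_ge0.
pose c := A / B ^+ j; have c0 : 0 <= c by rewrite divr_ge0// exprn_ge0// ltW.
have cf : continuous (fun x : R => (B + x ^+ 2)^-1).
  move=> x; apply: cvgV; first by rewrite gt_eqF.
  by apply: cvgD; [exact: cvg_cst|exact: exprn_continuous].
have mf : measurable_fun [set: R] (fun x : R => ((B + x ^+ 2)^-1)%:E).
  by apply/measurable_EFinP; exact: continuous_measurable_fun.
have fi (a : R) : 0 <= a ->
    (\int[mu]_x (a * (B + x ^+ 2)^-1)%:E = (a * (pi / Num.sqrt B))%:E)%E.
  move=> a0; under eq_integral do rewrite EFinM.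
  rewrite ge0_integralZl_EFin// ?integral_invr_sqrDl//.
  by move=> x _; rewrite lee_fin invr_ge0 ltW.
have D0 (x y : R) : 0 < B + x ^+ 2 + y ^+ 2 by rewrite ltr_wpDr// sqr_ge0.
have pos (x y : R) n : 0 <= A / (B + x ^+ 2 + y ^+ 2) ^+ n.
  by rewrite divr_ge0// exprn_ge0// ltW.
apply: (@le_trans _ _ (\int[mu]_x \int[mu]_y
    ((c * (B + x ^+ 2)^-1) * (B + y ^+ 2)^-1)%:E)%E).
  apply: ge0_le_integral_nomeas => x.
    by apply: integral_ge0 => y _; rewrite lee_fin.
  apply: ge0_le_integral_nomeas => y; first by rewrite lee_fin.
  rewrite lee_fin /c -!mulrA ler_wpM2l// -!invfM lef_pV2 ?posrE; last 2 first.
  - by rewrite exprn_gt0.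
  - by rewrite !mulr_gt0// exprn_gt0.
  rewrite -(addn2 j) (exprD _ j 2); apply: ler_pM.
  - by rewrite exprn_ge0// ltW.
  - by rewrite mulr_ge0// ltW.
  - by rewrite lerXn2r ?nnegrE ?(ltW B0) ?(ltW (D0 x y))// -addrA lerDl addr_ge0 ?sqr_ge0.
  - move: (sqr_ge0 x) (sqr_ge0 y); move: (x ^+ 2) (y ^+ 2) => a b a0 b0.
    have h1 := mulr_ge0 (ltW B0) a0; have h2 := mulr_ge0 (ltW B0) b0.
    have h3 := mulr_ge0 a0 b0; have h4 := sqr_ge0 a; have h5 := sqr_ge0 b.
    nra.
have p0 : 0 <= pi / Num.sqrt B by rewrite divr_ge0 ?pi_ge0 ?sqrtr_ge0.
under eq_integral => x _.
  rewrite fi; last by rewrite mulr_ge0// invr_ge0 ltW.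
  rewrite [X in X%:E](_ : _ = pi / Num.sqrt B * c * (B + x ^+ 2)^-1); last by ring.
  over.
rewrite (fi _ (mulr_ge0 p0 c0)) lee_fin /c le_eqVlt; apply/orP; left; apply/eqP.
have rB := sqr_sqrtr (ltW B0); have r0 : Num.sqrt B != 0 by rewrite gt_eqF ?sqrtr_gt0.
have Bj0 : B ^+ j != 0 by rewrite gt_eqF// exprn_gt0.
transitivity (A * pi ^+ 2 / (B ^+ j * Num.sqrt B ^+ 2)); last by rewrite rB -exprSr.
move: (Num.sqrt B) r0 => r r0; move: (B ^+ j) Bj0 => Bj Bj0.
by field; rewrite r0.
Qed.

(** Each complex variable costs one power of the denominator. The inner integrals are bounded first,
    with [B] plus the squared modulus of the outer variable in place of [B]; this leaves the
    exponent [j.+2] for the outer variable. *)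
Lemma iint_invr_sqmod_le k (A B : R) (j : nat) : 0 <= A -> 0 < B ->
  (iint k (fun s => (A / (B + \sum_(z <- s) sqmod z) ^+ (k + j.+1))%:E)
    <= (A * (pi ^+ 2) ^+ k / B ^+ j.+1)%:E)%E.
Proof.
elim: k A B j => [|k IH] A B j A0 B0 /=.
  by rewrite big_nil addr0 add0n expr0 mulr1.
have D0 (x y : R) : 0 < B + x ^+ 2 + y ^+ 2.
  by rewrite -addrA ltr_wpDr// addr_ge0 ?sqr_ge0.
have sq0 (z : C) : 0 <= sqmod z by rewrite addr_ge0 ?sqr_ge0.
have A'0 : 0 <= A * (pi ^+ 2) ^+ k by rewrite mulr_ge0// exprn_ge0// sqr_ge0.
rewrite (exprSr (pi ^+ 2)) mulrA; apply: le_trans (integral2_invr_le j A'0 B0).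
have H (s : seq C) n : 0 <= A / (B + \sum_(z <- s) sqmod z) ^+ n.
  by rewrite divr_ge0// exprn_ge0// addr_ge0 ?(ltW B0)// sumr_ge0.
apply: ge0_le_integral_nomeas => x.
  by apply: integral_ge0 => y _; apply: iint_ge0 => s; rewrite lee_fin.
apply: ge0_le_integral_nomeas => y.
  by apply: iint_ge0 => s; rewrite lee_fin.
apply: le_trans (IH _ _ j.+1 A0 (D0 x y)).
apply: le_iint => s; first by rewrite lee_fin.
by move=> _; rewrite big_cons lee_fin /sqmod /= !addrA addSnnS.
Qed.
End Integrals.

(** * Weighted integrals of polynomials *)

Section Sqmod.
Variable R : realType.
Local Notation C := (complex R).
Implicit Types (z w : C).

Lemma sqmodE z : (sqmod z)%:C%C = `|z| ^+ 2.
Proof. exact: add_Re2_Im2. Qed.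

Lemma sqmod_ge0 z : 0 <= sqmod z.
Proof. by rewrite addr_ge0 ?sqr_ge0. Qed.

Lemma sqmodM z w : sqmod (z * w) = sqmod z * sqmod w.
Proof. by case: z w => [a b] [c d]; rewrite /sqmod /=; ring. Qed.

Lemma sqmod0 : sqmod (0 : C) = 0.
Proof. by rewrite /sqmod /= !expr0n addr0. Qed.

Lemma sqmod1 : sqmod (1 : C) = 1.
Proof. by rewrite /sqmod /= expr1n expr0n addr0. Qed.

Lemma sqmod_eq0 z : (sqmod z == 0) = (z == 0).
Proof.
by case: z => a b; rewrite /sqmod /= paddr_eq0 ?sqr_ge0// !sqrf_eq0 eq_complex.
Qed.

Lemma sqmod_gt0 z : (0 < sqmod z) = (z != 0).
Proof. by rewrite lt0r sqmod_ge0 andbT sqmod_eq0. Qed.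

Lemma sqmodX z n : sqmod (z ^+ n) = sqmod z ^+ n.
Proof. by elim: n => [|n IH]; rewrite ?expr0 ?sqmod1// !exprS sqmodM IH. Qed.

Lemma sqmodV z : sqmod z^-1 = (sqmod z)^-1.
Proof.
have [->|z0] := eqVneq z 0; first by rewrite invr0 sqmod0 invr0.
have z0' : sqmod z != 0 by rewrite sqmod_eq0.
by apply: (mulfI z0'); rewrite -sqmodM !divff ?sqmod1.
Qed.

Lemma sqmod_prod I (r : seq I) (P : pred I) (f : I -> C) :
  sqmod (\prod_(i <- r | P i) f i) = \prod_(i <- r | P i) sqmod (f i).
Proof. exact: (big_morph _ sqmodM sqmod1). Qed.

(** On real and imaginary parts the difference of the two sides is a square divided by [e]. With [e]
    of order [1/M], the first coefficient stays bounded when raised to the power [M]. *)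
Lemma sqmodD_le (e : R) z w : 0 < e ->
  sqmod (z + w) <= (1 + e) * sqmod z + (1 + e^-1) * sqmod w.
Proof.
move=> e0; have H (a b : R) : (a + b) ^+ 2 <= (1 + e) * a ^+ 2 + (1 + e^-1) * b ^+ 2.
  rewrite -subr_ge0.
  have -> : (1 + e) * a ^+ 2 + (1 + e^-1) * b ^+ 2 - (a + b) ^+ 2 = (e * a - b) ^+ 2 / e.
    by field; rewrite gt_eqF.
  by rewrite divr_ge0 ?sqr_ge0// ltW.
case: z w => [a b] [c d]; rewrite /sqmod /=.
by have := H a c; have := H b d; lra.
Qed.

Lemma le_normc_sqmod z w : (`|z| <= `|w|) = (sqmod z <= sqmod w).
Proof. by rewrite -lecR !sqmodE ler_pXn2r ?nnegrE. Qed.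

Lemma sqmodR (a : R) : sqmod a%:C%C = a ^+ 2.
Proof. by rewrite /sqmod /= expr0n addr0. Qed.

End Sqmod.

#[local] Opaque sqmod.

Section SqmodSums.
Variable R : realType.
Local Notation C := (complex R).

Lemma sqmod_sum_le n (F : 'I_n -> C) :
  sqmod (\sum_(i < n) F i) <= n%:R * \sum_(i < n) sqmod (F i).
Proof.
elim: n F => [|n IH] F; first by rewrite !big_ord0 sqmod0 mulr0.
move: {IH}(IH (fun i => F (widen_ord (leqnSn n) i))).
rewrite !big_ord_recr /=; set s := \sum_(i < n) F _; set S := \sum_(i < n) sqmod _.
move=> IH; have [n0|n0] := posnP n.
  by subst n; rewrite /s /S !big_ord0 !add0r mul1r.
move: s S IH => s S sS; case: n n0 F sS => // n _ F sS.
(* This [e] turns both the old factor [n.+1] and the coefficient of the new term into [n.+2]. *)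
apply: le_trans (sqmodD_le _ _ (_ : 0 < n.+1%:R^-1)) _; first by rewrite invr_gt0.
rewrite invrK [n.+2%:R]mulrS (mulrDr _ S) lerD//.
apply: (@le_trans _ _ ((1 + n.+1%:R^-1) * (n.+1%:R * S))).
  by rewrite ler_wpM2l// addr_ge0// invr_ge0.
by rewrite mulrA mulrDl mul1r mulVf ?pnatr_eq0// addrC.
Qed.

Lemma horner_sqmod_le (p : {poly C}) (M : nat) (K : R) : 1 <= K ->
  (size p <= M.+1)%N ->
  exists B, forall z, sqmod p.[z] <= B * (1 + K * sqmod z) ^+ M.
Proof.
move=> K1 sp; exists (M.+1%:R * \sum_(i < M.+1) sqmod p`_i) => z.
have K0 : 0 <= K by apply: le_trans K1.
have s1 : sqmod z <= 1 + K * sqmod z.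
  by rewrite -[leLHS]add0r lerD// ler_peMl// sqmod_ge0.
have s2 : 1 <= 1 + K * sqmod z by rewrite lerDl mulr_ge0// sqmod_ge0.
rewrite (horner_coef_wide _ sp); apply: le_trans (sqmod_sum_le _) _.
rewrite -mulrA ler_wpM2l// mulr_suml; apply: ler_sum => i _.
rewrite sqmodM sqmodX ler_wpM2l ?sqmod_ge0//.
apply: (@le_trans _ _ ((1 + K * sqmod z) ^+ i)).
  by rewrite lerXn2r ?nnegrE ?sqmod_ge0// (le_trans _ s2).
by rewrite ler_weXn2l// -ltnS.
Qed.

(** The power is at most [expR 1], and [expR (2^-1) <= 2] follows from
    [1 - 2^-1 <= expR (- 2^-1)]. *)
Lemma expr1DV_le4 (M : nat) : (1 + M.+1%:R^-1 : R) ^+ M.+1 <= 4.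
Proof.
apply: (@le_trans _ _ (expR 1)); last first.
  have : 1 - 2^-1 <= expR (- 2^-1) :> R by rewrite expR_ge1Dx.
  have -> : expR 1 = expR (2^-1) * expR (2^-1) :> R.
    by rewrite -expRD; congr expR; lra.
  rewrite expRN => h.
  have e2 : expR (2^-1) <= 2 :> R.
    rewrite -[leRHS]invrK -[leLHS]invrK lef_pV2 ?posrE ?invr_gt0 ?expR_gt0//.
    by apply: le_trans h; lra.
  by have := expR_gt0 (2^-1 : R); nra.
have -> : expR 1 = expR (M.+1%:R^-1) ^+ M.+1 :> R.
  by rewrite -expRM_natl mulfV ?pnatr_eq0.
by rewrite lerXn2r ?nnegrE ?expR_ge0 ?expR_ge1Dx// addr_ge0// invr_ge0.
Qed.

End SqmodSums.

Section PolyMean.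
Variable R : realType.
Local Notation C := (complex R).
Local Notation mu := (@lebesgue_measure R).

(* At a near-maximum z0 of the weighted modulus, p is controlled by p(z0) on a disc of
   radius ~ 1/M, so by Cauchy's estimates |p| stays above |p(z0)|/2 on a smaller one.
   In D, 2^11 = 32 * 64: the integrand exceeds 1/32 of its value at z1 on a square of
   area 1/64 of the squared radius. *)
Lemma poly_weighted_lower (p : {poly C}) (M : nat) (K A D : R) (z1 : C) :
  1 <= K -> 0 <= A -> D = 2 ^+ 11 * K * (M.+1 * M.+2)%:R -> (size p <= M.+2)%N ->
  ((A * sqmod p.[z1] / D)%:E <=
   \int[mu]_x \int[mu]_y
     (A * sqmod p.[(x +i* y)%C] / (1 + K * sqmod ((x +i* y)%C - z1)) ^+ M.+1)%:E)%E.
Proof.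
have -> : 2 ^+ 11 = 2048 :> R by rewrite -natrX.
move=> K1 A0 -> sp; have K0 : 0 < K by apply: lt_le_trans K1.
pose w z := 1 + K * sqmod (z - z1).
have w1 z : 1 <= w z by rewrite lerDl mulr_ge0 ?sqmod_ge0 // ltW.
have w0 z : 0 < w z by apply: lt_le_trans (w1 z).
pose Psi z := sqmod p.[z] / w z ^+ M.+1.
have Psi0 z : 0 <= Psi z by rewrite divr_ge0 ?sqmod_ge0 ?exprn_ge0// ltW.
have [B PB] : exists B, forall z, Psi z <= B.
  pose q := p \Po ('X + z1%:P).
  have sq : (size q <= M.+2)%N by rewrite size_comp_poly2 // size_XaddC.
  have [B HB] := horner_sqmod_le K1 sq; exists B => z.
  rewrite /Psi ler_pdivrMr ?exprn_gt0//.
  by have := HB (z - z1); rewrite /q horner_comp hornerD hornerX hornerC subrK.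
(* A point reaching half of the supremum is enough, so no maximum has to be attained. *)
have [z0 z0P] : exists z0, forall z, Psi z <= 2 * Psi z0.
  pose S := sup (range Psi).
  have ubS : has_ubound (range Psi) by exists B => _ [z _ <-].
  have leS z : Psi z <= S by apply: ub_le_sup => //; exists z.
  have S0 : 0 <= S by apply: le_trans (leS z1).
  have [S00|SN0] := eqVneq S 0.
    by exists z1 => z; rewrite (le_trans (leS z))// S00 mulr_ge0.
  have Spos : 0 < S by rewrite lt0r SN0.
  have ne0 : range Psi !=set0 by exists (Psi z1), z1.
  have SS : S / 2 < S by lra.
  have [_ [z0 _ <-] h] := sup_gt ne0 SS.
  by exists z0 => z; rewrite (le_trans (leS z))//; lra.
pose m1 : R := M.+1%:R; have m10 : 0 < m1 by rewrite ltr0n.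
have m2E : M.+2%:R = 1 + m1 :> R by rewrite mulrS.
(* The squared radius is chosen so that [K * (1 + m1) * rho2 = m1^-1]: on this disc the weight [w]
   grows at most by the factor [1 + m1^-1], hence its power by at most 4. *)
pose rho2 : R := (K * (m1 * (1 + m1)))^-1.
have den0 : 0 < K * (m1 * (1 + m1)) by rewrite !mulr_gt0// addr_gt0.
have rho20 : 0 < rho2 by rewrite invr_gt0.
have wle t : sqmod t <= rho2 -> w (z0 + t) <= (1 + m1^-1) * w z0.
  move=> trho; rewrite /w addrAC.
  have h : sqmod (z0 - z1 + t) <= (1 + m1^-1) * sqmod (z0 - z1) + (1 + m1) * rho2.
    have im0 : 0 < m1^-1 by rewrite invr_gt0.
    apply: le_trans (sqmodD_le _ _ im0) _; rewrite invrK lerD2l ler_wpM2l//.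
    by rewrite addr_ge0// ltW.
  have e : K * ((1 + m1) * rho2) = m1^-1.
    by rewrite /rho2; field; rewrite !gt_eqF// addr_gt0.
  have := ler_wpM2l (ltW K0) h; rewrite (mulrDr K _ ((1 + m1) * rho2)) e => h2.
  move: h2; move: (sqmod (z0 - z1)) (sqmod (_ + t)) => s s' h2.
  have -> : (1 + m1^-1) * (1 + K * s) = 1 + m1^-1 + K * ((1 + m1^-1) * s) by ring.
  by rewrite -addrA lerD2l addrC.
have wXle t : sqmod t <= rho2 -> w (z0 + t) ^+ M.+1 <= 4 * w z0 ^+ M.+1.
  move=> /wle h; apply: (@le_trans _ _ (((1 + m1^-1) * w z0) ^+ M.+1)).
    by rewrite lerXn2r ?nnegrE ?(ltW (w0 _))// mulr_ge0 ?(ltW (w0 _))// addr_ge0// invr_ge0 ltW.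
  by rewrite exprMn ler_wpM2r ?expr1DV_le4// exprn_ge0// ltW.
(* The 8 is 2 from near-maximality times 4 from the growth of the weight. *)
have ple t : sqmod t <= rho2 -> sqmod p.[z0 + t] <= 8 * sqmod p.[z0].
  move=> trho; have h := z0P (z0 + t).
  have E z : sqmod p.[z] = Psi z * w z ^+ M.+1.
    by rewrite /Psi divfK// gt_eqF// exprn_gt0.
  rewrite !E; apply: (@le_trans _ _ ((2 * Psi z0) * (4 * w z0 ^+ M.+1))); last by lra.
  apply: ler_pM => //; last exact: wXle.
  by rewrite exprn_ge0// ltW.
(* As 8 is at most 9, [|p|] is bounded by [3 * |p(z0)|] on the circle. Cauchy's estimate at one
   eighth of the radius then gives [7 * |p(z0 + t) - p(z0)| <= 3 * |p(z0)|], so [|p(z0 + t)|] is at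
   least 4/7, hence 1/2, of [|p(z0)|]. *)
have plow t : 64 * sqmod t <= rho2 -> sqmod p.[z0] / 4 <= sqmod p.[z0 + t].
  move=> trho; pose q := p \Po ('X + z0%:P).
  have qE s : q.[s] = p.[z0 + s] by rewrite /q horner_comp hornerD hornerX hornerC addrC.
  pose r : C := (Num.sqrt rho2)%:C%C.
  have r0 : 0 <= r by rewrite lecR sqrtr_ge0.
  have rsq : sqmod r = rho2 by rewrite sqmodR sqr_sqrtr// ltW.
  have c3 : `|3 * p.[z0]| = 3 * `|p.[z0]| by rewrite normrM normr_nat.
  have sq3 : sqmod (3 * p.[z0]) = 9 * sqmod p.[z0].
    by rewrite sqmodM -(rmorph_nat (real_complex R)) sqmodR; congr (_ * _); ring.
  have sqn (a : nat) (u : C) : sqmod (a%:R * u) = a%:R ^+ 2 * sqmod u.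
    by rewrite sqmodM -(rmorph_nat (real_complex R)) sqmodR.
  have := @horner_sub0_le _ q r (`|3 * p.[z0]|) t r0 _ _.
  rewrite !qE addr0 => /(_ _ _)/wrap[].
    move=> s sr; rewrite qE le_normc_sqmod sq3.
    apply: (@le_trans _ _ (8 * sqmod p.[z0])); last first.
      by rewrite ler_wpM2r ?sqmod_ge0// ler_nat.
    apply: ple; rewrite -rsq -le_normc_sqmod sr.
    by rewrite ger0_norm.
  - rewrite -[leRHS](ger0_norm r0) -[8 * _]/(8%:R * _) -(normr_nat C 8) -normrM le_normc_sqmod sqn rsq.
    by apply: le_trans trho; rewrite ler_wpM2r ?sqmod_ge0//; lra.
  rewrite c3 => h.
  have h2 : `|p.[z0]| <= 2 * `|p.[z0 + t]|.
    have := lerB_dist p.[z0] (p.[z0 + t]); rewrite distrC.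
    move: h; set a := `|p.[z0]|; set b := `|p.[z0 + t]|; set c := `|_ - _|.
    have a0 : 0 <= a by exact: normr_ge0.
    move=> h h'.
    have : 7 * (a - b) <= 3 * a by apply: le_trans h; rewrite ler_wpM2l.
    rewrite mulrBr lerBlDr -lerBlDl -mulrBl -natrB// => h3.
    rewrite -(ler_pM2l (_ : 0 < 4 :> C)) //.
    apply: le_trans h3 _; rewrite mulrA -natrM ler_wpM2r ?normr_ge0// ler_nat//.
  rewrite ler_pdivrMr// mulrC.
  have := h2; rewrite -[2](normr_nat C 2) -normrM le_normc_sqmod sqn => h4.
  by apply: le_trans h4 _; rewrite -natrX.
pose d := Num.sqrt rho2 / 16.
have d0 : 0 < d by rewrite divr_gt0// sqrtr_gt0.
have d2 : d ^+ 2 = rho2 / 256.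
  by rewrite /d exprMn sqr_sqrtr ?ltW// exprVn; congr (_ / _); ring.
(* The 32 collects 2 from passing from [z1] to [z0], 4 from the lower bound on [p] and 4 from the
   growth of the weight. *)
pose c := A * Psi z1 / 32.
have c0 : 0 <= c by rewrite divr_ge0// mulr_ge0.
have -> : A * sqmod p.[z1] / (2048 * K * (M.+1 * M.+2)%:R) = c * (2 * d) ^+ 2.
  rewrite exprMn d2 /c /Psi /w subrr sqmod0 mulr0 addr0 expr1n divr1 natrM m2E -/m1 /rho2.
  by field; rewrite !gt_eqF// addr_gt0.
case: z0 z0P {wle} wXle ple plow => a b z0P wXle ple plow.
apply: (@ge_integral2_box _ _ a b) => //.
  move=> x y; rewrite lee_fin divr_ge0 ?mulr_ge0 ?sqmod_ge0// exprn_ge0//.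
  exact: (ltW (w0 _)).
move=> x y xa yb; rewrite lee_fin /c -[A * _ / 32]mulrA -[A * _ / _]mulrA ler_wpM2l//.
pose t : C := ((x - a) +i* (y - b))%C.
have tE : (x +i* y)%C = (a +i* b)%C + t.
  by rewrite /t; apply/eqP; rewrite eq_complex /= !subrKC !eqxx.
have td : sqmod t <= 2 * d ^+ 2.
  have s2 (u : R) : `|u| <= d -> u ^+ 2 <= d ^+ 2.
    by move=> ud; rewrite -(real_normK (num_real u)) lerXn2r ?nnegrE// ltW.
  have -> : sqmod t = (x - a) ^+ 2 + (y - b) ^+ 2 by [].
  by have := s2 _ xa; have := s2 _ yb; lra.
have t64 : 64 * sqmod t <= rho2 by rewrite d2 in td; lra.
have t1 : sqmod t <= rho2 by have := sqmod_ge0 t; lra.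
rewrite tE -/(w _).
apply: (@le_trans _ _ (Psi (a +i* b)%C / 16)); first by have := z0P z1; lra.
rewrite ler_pdivlMr ?exprn_gt0//.
apply: (@le_trans _ _ (Psi (a +i* b)%C / 16 * (4 * w (a +i* b)%C ^+ M.+1))).
  by rewrite ler_wpM2l ?wXle// divr_ge0.
apply: le_trans (plow _ t64); rewrite /Psi.
have := w0 (a +i* b)%C; have := exprn_gt0 M.+1 (w0 (a +i* b)%C).
move: (w _ ^+ _) => u u0 _; rewrite le_eqVlt; apply/orP; left; apply/eqP.
by field; rewrite gt_eqF.
Qed.

End PolyMean.

Section IteratedLower.
Variable R : realType.
Local Notation C := (complex R).
Implicit Types (f : seq C -> C) (s a : seq C).

(** Polynomial dependence on each entry separately. Prefix and suffix are arbitrary, so the property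
    survives fixing the first entries of the list. *)
Definition sep_poly d f := forall s1 s2,
  exists2 p : {poly C}, (size p <= d.+1)%N & forall z, f (s1 ++ z :: s2) = p.[z].

(** The one-variable bound is applied to the outer variable with the others frozen at [a]; for each
    value [z] of it, the induction hypothesis treats [f (z :: s)]. The factor [A] is arbitrary so
    that it can absorb the weight of the outer variable. *)
Lemma iint_weighted_lower k f (M : nat) (K A D : R) a :
  1 <= K -> D = 2 ^+ 11 * K * (M.+1 * M.+2)%:R -> 0 <= A -> size a = k -> sep_poly M.+1 f ->
  ((A * sqmod (f a) / D ^+ k)%:E <=
   iint k (fun s => (A * sqmod (f s) /
     \prod_(u <- zip s a) (1 + K * sqmod (u.1 - u.2)) ^+ M.+1)%:E))%E.
Proof.
move=> K1 DE; elim: k f A a => [|k IH] f A [|a0 a]//= A0; first by rewrite big_nil.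
move=> [sa] sf; have K0 : 0 < K by apply: lt_le_trans K1.
have D0 : 0 < D by rewrite DE mulr_gt0 ?ltr0n// mulr_gt0// exprn_gt0.
have w0 (z : C) : 0 < 1 + K * sqmod z by rewrite ltr_wpDr// mulr_ge0 ?sqmod_ge0// ltW.
have prod0 s b : 0 <= \prod_(u <- zip s b) (1 + K * sqmod (u.1 - u.2)) ^+ M.+1.
  by rewrite prodr_ge0// => u _; rewrite exprn_ge0// ltW.
have [p sp fp] := sf [::] a; rewrite -[a0 :: a]cat0s fp.
have -> : A * sqmod p.[a0] / D ^+ k.+1 = (A / D ^+ k) * sqmod p.[a0] / D.
  by rewrite exprSr; field; rewrite gt_eqF// expf_neq0// gt_eqF.
apply: le_trans (poly_weighted_lower a0 K1 _ DE sp) _.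
  by rewrite divr_ge0// exprn_ge0// ltW.
apply: ge0_le_integral_nomeas => x.
  apply: integral_ge0 => y _.
  by rewrite lee_fin !divr_ge0 ?mulr_ge0 ?sqmod_ge0 ?exprn_ge0 ?invr_ge0 ?exprn_ge0 ?(ltW (w0 _)) ?(ltW D0).
apply: ge0_le_integral_nomeas => y.
  by rewrite lee_fin !divr_ge0 ?mulr_ge0 ?sqmod_ge0 ?exprn_ge0 ?invr_ge0 ?exprn_ge0 ?(ltW (w0 _)) ?(ltW D0).
set z := (x +i* y)%C; pose A' := A / (1 + K * sqmod (z - a0)) ^+ M.+1.
have A'0 : 0 <= A' by rewrite divr_ge0// exprn_ge0// ltW.
have sf' : sep_poly M.+1 (fun s => f (z :: s)) by move=> s1 s2; exact: (sf (z :: s1) s2).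
have := IH _ _ a A'0 sa sf'.
have -> : A' * sqmod (f (z :: a)) / D ^+ k =
    A / D ^+ k * sqmod p.[z] / (1 + K * sqmod (z - a0)) ^+ M.+1.
  by rewrite -[z :: a]cat0s fp /A'; ring.
move=> /le_trans; apply; apply: le_iint => s.
  by rewrite lee_fin divr_ge0// mulr_ge0 ?sqmod_ge0.
by move=> _; rewrite big_cons lee_fin /A' invfM; rewrite le_eqVlt; apply/orP; left; apply/eqP; ring.
Qed.

End IteratedLower.

(** * Diagonalization of the hermitian form *)

Section LDL.
Variable R : realType.
Local Notation C := (complex R).

Lemma conjTM m n p (A : 'M[C]_(m, n)) (B : 'M[C]_(n, p)) :
  conjT (A *m B) = conjT B *m conjT A.
Proof. by rewrite /conjT trmx_mul map_mxM. Qed.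

Lemma conjTK m n : cancel (@conjT R m n) (@conjT R n m).
Proof. by move=> A; apply/matrixP => i j; rewrite !mxE conjcK. Qed.

Lemma conjT_block m1 m2 n1 n2 (A : 'M[C]_(m1, n1)) B (D : 'M[C]_(m2, n1)) E :
  conjT (block_mx A B D E : 'M[C]_(m1 + m2, n1 + n2)) =
  block_mx (conjT A) (conjT D) (conjT B) (conjT E).
Proof. by rewrite /conjT tr_block_mx map_block_mx. Qed.

Lemma conjT0 m n : conjT (0 : 'M[C]_(m, n)) = 0.
Proof. by rewrite /conjT trmx0 map_mx0. Qed.

Lemma conjT1 n : conjT (1%:M : 'M[C]_n) = 1%:M.
Proof. by rewrite /conjT trmx1 map_mx1. Qed.

(** The condition [hermitian_pd] in every size, so that inductions can start at the empty matrix. *)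
Definition pdmx n (P : 'M[C]_n) := conjT P = P /\
  forall v : 'cV[C]_n, v != 0 -> 0 < complex.Re ((conjT v *m P *m v) 0 0).

Definition unitrig n (L : 'M[C]_n) := is_trig_mx L /\ forall i, L i i = 1.

Lemma det_unitrig n (L : 'M[C]_n) : unitrig L -> \det L = 1.
Proof. by move=> [Lt L1]; rewrite det_trig// big1. Qed.

Lemma unitrig_block n x (L : 'M[C]_n) : unitrig L ->
  unitrig (block_mx (1%:M : 'M[C]_1) 0 x L).
Proof.
move=> [Lt L1]; split.
  by rewrite is_trig_block_mx// eqxx Lt scalar_mx_is_trig.
move=> i; case: (split_ordP i) => j ->; first by rewrite block_mxEul mxE eqxx.
by rewrite block_mxEdr.
Qed.

(** Elimination from the lower right corner: the trailing block is diagonalized by induction, and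
    the new pivot is its Schur complement. This order makes [L] lower triangular and ties the pivots
    to the trailing minors. *)
Lemma ldl_exists n (P : 'M[C]_n) : pdmx P ->
  exists L A (d : 'rV[R]_n), [/\ unitrig L, unitrig A, L *m A = 1%:M,
    conjT L *m P *m L = diag_mx (map_mx (real_complex R) d) &
    forall i, 0 < d 0 i].
Proof.
elim: n P => [|n IH] P.
  move=> _; exists 1%:M, 1%:M, 0; split; try by move=> [].
  - by split; [exact: scalar_mx_is_trig|move=> []].
  - by split; [exact: scalar_mx_is_trig|move=> []].
  - by rewrite mul1mx.
  - by apply/matrixP => -[].
rewrite -[n.+1]/(1 + n)%N in P *.
rewrite -[P]submxK; set p := ulsubmx P; set q' := ursubmx P.
set q := dlsubmx P; set P' := drsubmx P.
move=> [hP pP]; move: hP; rewrite conjT_block => /eq_block_mx[hp hq' hq hP'].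
have pd' : pdmx P'.
  split=> // v v0; have := pP (col_mx 0 v).
  have -> : col_mx 0 v != 0 :> 'cV_(1 + n).
    by apply: contra_neq v0 => /eqP; rewrite col_mx_eq0 => /andP[_ /eqP].
  move=> /(_ isT); rewrite /conjT tr_col_mx map_row_mx mul_row_block.
  by rewrite trmx0 map_mx0 !mul0mx !add0r mul_row_col mulmx0 add0r.
have [L [A [d [uL uA LA LPL d0]]]] := IH _ pd'.
have uP' : P' \in unitmx.
  have : conjT L *m P' *m L \in unitmx.
    rewrite LPL unitmxE det_diag unitfE; apply/prodf_neq0 => i _.
    by rewrite mxE; apply: contra_neq (lt0r_neq0 (d0 i)) => -[].
  by rewrite !unitmx_mul => /andP[/andP[]].
(* The column [(1, x)] is the one whose image under [P] vanishes below the first entry, so all cross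
   terms disappear. *)
pose x := - (invmx P' *m q).
have qx : q + P' *m x = 0 by rewrite /x mulmxN mulKVmx// subrr.
have qx' : q' + conjT x *m P' = 0.
  rewrite -hq' -{1}hP' -conjTM -[0]conjT0 -qx /conjT.
  by rewrite linearD /= map_mxD.
pose d0' := complex.Re ((p + q' *m x) 0 0).
have LPL0 : conjT (col_mx (1%:M : 'M[C]_1) x) *m block_mx p q' q P' *m col_mx (1%:M : 'M[C]_1) x
    = p + q' *m x.
  rewrite -mulmxA mul_block_col !mulmx1 qx /conjT tr_col_mx map_row_mx trmx1 map_mx1.
  by rewrite mul_row_col mulmx0 addr0 mul1mx.
(* The pivot is the value of a hermitian form, hence real. *)
have pE : p + q' *m x = (d0'%:C%C)%:M.
  rewrite [LHS]mx11_scalar; congr (_%:M).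
  have : conjT (p + q' *m x) = p + q' *m x.
    by rewrite -LPL0 !conjTM conjTK mulmxA conjT_block hp hq' hq hP'.
  move=> /matrixP/(_ 0 0); rewrite !mxE /d0' !mxE.
  case: (_ + _) => u v /= [] /eqP; rewrite eq_sym -subr_eq0 opprK -mulr2n mulrn_eq0 /=.
  by move=> /eqP ->.
have d0'0 : 0 < d0'.
  rewrite /d0' -LPL0; apply: pP.
  apply/eqP => /matrixP/(_ (lshift _ 0) 0); rewrite col_mxEu !mxE => /eqP.
  by rewrite oner_eq0.
exists (block_mx 1%:M 0 x L), (block_mx 1%:M 0 (- (A *m x)) A), (row_mx (const_mx d0') d).
split.
- exact: unitrig_block.
- exact: unitrig_block.
- rewrite mulmx_block !mulmx1 !mul0mx !mulmx0 !addr0 add0r LA mulmxN mulmxA LA mul1mx subrr.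
  by rewrite -scalar_mx_block.
- rewrite conjT_block conjT1 conjT0 -mulmxA mulmx_block !mulmx1 qx !mulmx0 !add0r.
  rewrite mulmx_block !mulmx0 !mul0mx !mul1mx !addr0 add0r (mulmxA (conjT L)) LPL.
  rewrite (mulmxA (conjT x)) -mulmxDl qx' mul0mx map_row_mx diag_mx_row; congr block_mx.
  by rewrite pE; apply/matrixP => i j; rewrite !mxE !ord1.
- move=> i; case: (split_ordP i) => j ->; first by rewrite row_mxEl mxE.
  by rewrite row_mxEr.
Qed.

Lemma sum_inord_tail (V : nmodType) n i (F : 'I_n.+1 -> V) : (i <= n.+1)%N ->
  (forall k : 'I_n.+1, (k < i)%N -> F k = 0) ->
  \sum_k F k = \sum_(j < n.+1 - i) F (inord (i + j)).
Proof.
move=> ni F0.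
transitivity (\sum_(0 <= k < n.+1) F (inord k)).
  by rewrite big_mkord; apply: eq_bigr => k _; rewrite inord_val.
rewrite (big_cat_nat (leq0n i) ni) /= big_nat big1 ?add0r.
  rewrite -{1}(add0n i) big_addn big_mkord.
  by apply: eq_bigr => j _; rewrite addnC.
by move=> k /andP[_ ki]; apply: F0; rewrite inordK// (leq_trans ki).
Qed.

(** As [L] is lower triangular, the trailing block of [conjT L *m P *m L] involves only the trailing
    blocks of [L] and [P], and that of [L] has determinant 1. *)
Lemma det_from_ldl n (P L : 'M[C]_n.+1) (d : 'rV[R]_n.+1) i : unitrig L ->
  conjT L *m P *m L = diag_mx (map_mx (real_complex R) d) -> (i <= n.+1)%N ->
  det_from P i = \prod_(i <= k < n.+1) (d 0 (inord k))%:C%C.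
Proof.
move=> [Lt L1] LPL ni; have Lt0 (k j : 'I_n.+1) : (k < j)%N -> L k j = 0 by move/is_trig_mxP: Lt; apply.
pose S (M : 'M[C]_n.+1) : 'M[C]_(n.+1 - i) :=
  \matrix_(j, k) M (inord (i + j)) (inord (i + k)).
have inK (j : 'I_(n.+1 - i)) : (inord (i + j) : 'I_n.+1) = i + j :> nat.
  by rewrite inordK// -ltn_subRL.
have uS : unitrig (S L).
  split; last by move=> j; rewrite mxE.
  by apply/is_trig_mxP => j k jk; rewrite mxE Lt0// !inK ltn_add2l.
have SE : conjT (S L) *m S P *m S L = S (conjT L *m P *m L).
  apply/matrixP => a b; rewrite !mxE (sum_inord_tail ni); last first.
    by move=> k ki; rewrite Lt0 ?mulr0// inK (leq_trans ki) ?leq_addr.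
  apply: eq_bigr => k _; rewrite !mxE; congr (_ * _).
  rewrite (sum_inord_tail ni); last first.
    by move=> l li; rewrite !mxE Lt0 ?rmorph0 ?mul0r// inK (leq_trans li) ?leq_addr.
  by apply: eq_bigr => l _; rewrite !mxE.
have : \det (conjT (S L) *m S P *m S L) = det_from P i.
  rewrite !det_mulmx (det_unitrig uS) mulr1 /conjT det_map_mx det_tr (det_unitrig uS).
  by rewrite rmorph1 mul1r.
move=> <-; rewrite SE LPL.
have -> : S (diag_mx (map_mx (real_complex R) d)) =
    diag_mx (\row_j (d 0 (inord (i + j)))%:C%C).
  apply/matrixP => a b; rewrite !mxE; congr (_ *+ nat_of_bool _).
  by rewrite -!val_eqE /= !inK eqn_add2l.
rewrite det_diag; symmetry; rewrite -{1}(add0n i) big_addn big_mkord.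
by apply: eq_bigr => j _; rewrite mxE addnC.
Qed.

(** The quotient of two consecutive trailing minors is a single pivot, so the diagonal entries are
    the [mu_ P i]. *)
Lemma hermitian_pd_diag n (P : 'M[C]_n.+1) : hermitian_pd P ->
  exists L A : 'M[C]_n.+1, [/\ unitrig L, unitrig A, A *m L = 1%:M,
    forall i : 'I_n.+1, 0 < mu_ P i &
    forall v : 'cV[C]_n.+1, complex.Re ((conjT v *m P *m v) 0 0) =
      \sum_(i < n.+1) mu_ P i * sqmod ((A *m v) i 0)].
Proof.
move=> hP; have [L [A [d [uL uA LA LPL d0]]]] := ldl_exists hP.
have dC0 k : (d 0 k)%:C%C != 0 :> C.
  by apply: contra_neq (lt0r_neq0 (d0 k)) => -[].
have muE (i : 'I_n.+1) : mu_ P i = d 0 i.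
  have ilt := ltn_ord i.
  rewrite /mu_ (det_from_ldl uL LPL (ltnW ilt)) (det_from_ldl uL LPL ilt).
  rewrite big_ltn// mulfK ?inord_val//.
  by rewrite prodf_seq_neq0; apply/allP => k _ /=; rewrite dC0.
exists L, A; split=> //; first exact: mulmx1C.
  by move=> i; rewrite muE.
move=> v; have : v = L *m (A *m v) by rewrite mulmxA LA mul1mx.
move: (A *m v) => w ->.
have -> : conjT (L *m w) *m P *m (L *m w) = conjT w *m (conjT L *m P *m L) *m w.
  by rewrite conjTM !mulmxA.
rewrite LPL mxE raddf_sum; apply: eq_bigr => i _.
rewrite muE mul_mx_diag !mxE.
case: (w i 0) => a b; have -> : sqmod (a +i* b)%C = a ^+ 2 + b ^+ 2 by [].
by rewrite /=; ring.
Qed.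

End LDL.

(** * Maximum principle on tori *)

Section TorusPoint.
Variable R : realType.
Local Notation C := (complex R).

(** Exponents of [z^a] homogenized to degree [M]: the last coordinate receives the missing
    degree. *)
Definition hexp n m (M : nat) (a : mindex n m) (i : 'I_n.+1) : nat :=
  if unlift ord_max i is Some j then a j : nat else (M - mdeg a)%N.

Lemma hexp_lift n m M (a : mindex n m) j : hexp M a (lift ord_max j) = a j.
Proof. by rewrite /hexp liftK. Qed.

Lemma hexp_max n m M (a : mindex n m) : hexp M a ord_max = (M - mdeg a)%N.
Proof. by rewrite /hexp unlift_none. Qed.

Definition hpeval n m M (k : {ffun mindex n m -> C}) (Z : 'cV[C]_n.+1) : C :=
  \sum_a k a * \prod_i Z i 0 ^+ hexp M a i.

Lemma big_ord_lift_max (T : Type) (idx : T) (op : Monoid.com_law idx) n (F : 'I_n.+1 -> T) :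
  \big[op/idx]_i F i = op (\big[op/idx]_(j < n) F (lift ord_max j)) (F ord_max).
Proof.
rewrite big_ord_recr; congr (op _ _); apply: eq_bigr => j _; congr F.
by apply/val_inj; rewrite /= /bump leqNgt ltn_ord.
Qed.

Lemma sum_hexp n m M (a : mindex n m) : (mdeg a <= M)%N -> (\sum_i hexp M a i)%N = M.
Proof.
move=> aM; rewrite big_ord_lift_max /= hexp_max.
under eq_bigr do rewrite hexp_lift.
by rewrite -/(mdeg a) subnKC.
Qed.

(** The terms of the homogenization that agree with [b] before index [i], stripped of their common
    factors in the coordinates before [i]. *)
Let tail n m M (k : {ffun mindex n m -> C}) (b : mindex n m) (i : nat) (Z : 'cV[C]_n.+1) : C :=
  \sum_(a : mindex n m | [forall j : 'I_n, (j < i)%N ==> (a j == b j)])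
    k a * \prod_(j < n.+1 | (i <= j)%N) Z j 0 ^+ hexp M a j.

(* The coordinates of w = L^-1 Z are switched on from the last one to the first: since
   no term of k precedes z^b, the i-th one only factors out w_i^(b_i), and the maximum
   principle handles the cofactor. *)
Lemma torus_tail n m M (k : {ffun mindex n m -> C}) (b : mindex n m)
    (L : 'M[C]_n.+1) (rho : 'I_n.+1 -> R) i :
  A_set b k -> unitrig L -> (forall j, 0 <= rho j) -> (i <= n)%N ->
  exists w : 'cV[C]_n.+1, [/\ forall j : 'I_n.+1, (j < i)%N -> w j 0 = 0,
    forall j : 'I_n.+1, (i <= j)%N -> sqmod (w j 0) = rho j &
    \prod_(j < n.+1 | (i <= j)%N) rho j ^+ hexp M b j <= sqmod (tail M k b i (L *m w))].
Proof.
move=> [ks [kb klt]] [Lt L1] rho0 ni.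
have Lt0 (k' j : 'I_n.+1) : (k' < j)%N -> L k' j = 0 by move/is_trig_mxP: Lt; apply.
pose r j : C := (Num.sqrt (rho j))%:C%C.
have rsq j : sqmod (r j) = rho j by rewrite sqmodR sqr_sqrtr.
rewrite -(subKn ni); elim: {ni}(n - i)%N (leq_subr i n) => [_|e IH en].
  rewrite subn0; exists (\col_j (if j == ord_max then r ord_max else 0)).
  have eqmax (j : 'I_n.+1) : (n <= j)%N = (j == ord_max).
    by rewrite -val_eqE /= eqn_leq leq_ord.
  split.
  - by move=> j jn; rewrite mxE -eqmax leqNgt jn.
  - by move=> j; rewrite eqmax mxE => /eqP ->; rewrite eqxx.
  have prodmax (S : comNzRingType) (F : 'I_n.+1 -> S) :
      \prod_(j < n.+1 | (n <= j)%N) F j = F ord_max.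
    by rewrite (eq_bigl _ _ eqmax) big_pred1_eq.
  (* At [i = n] all exponents are prescribed, so [b] is the only index left. *)
  rewrite prodmax /tail (big_pred1 b) => [|a]; last first.
    apply/forallP/eqP => [H|-> j]; last by rewrite eqxx implybT.
    by apply/ffunP => j; apply/eqP; have := H j; rewrite ltn_ord.
  rewrite prodmax kb mul1r sqmodX mxE (bigD1 ord_max) //= big1 ?addr0.
    by rewrite mxE eqxx L1 mul1r rsq.
  by move=> j /negPf jn; rewrite mxE jn mulr0.
have [w [w0 wr wge]] := IH (ltnW en).
set i' := (n - e)%N in w0 wr wge; set i0 := (n - e.+1)%N.
have ii : i' = i0.+1 by rewrite /i' /i0 -subSn.
have i0n : (i0 < n)%N by rewrite -ii leq_subr.
pose ii0 : 'I_n := Ordinal i0n; pose I0 : 'I_n.+1 := lift ord_max ii0.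
have I0E : I0 = i0 :> nat by rewrite /= /bump leqNgt i0n.
pose P (a : mindex n m) := [forall j : 'I_n, (j < i0)%N ==> (a j == b j)].
(* The tail at [i0] divided by [t ^+ b ii0], as a polynomial in the new coordinate [t]. Indices with
   [a ii0 < b ii0] precede [b] and carry zero coefficients. *)
pose h : {poly C} := \sum_(a : mindex n m | P a && (b ii0 <= a ii0)%N)
  (k a)%:P * 'X^(a ii0 - b ii0) *
  \prod_(j < n.+1 | (i0 < j)%N) (((L *m w) j 0)%:P + (L j I0)%:P * 'X) ^+ hexp M a j.
pose wt t : 'cV[C]_n.+1 := w + t *: delta_mx I0 0.
have LwtE t j : (L *m wt t) j 0 = (L *m w) j 0 + L j I0 * t.
  rewrite mulmxDr -scalemxAr -colE !mxE; congr (_ + _); exact: mulrC.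
(* Row [I0] of [L] sees only coordinates not yet switched on; hence after the shift this entry is
   exactly [t]. *)
have Lw0 : (L *m w) I0 0 = 0.
  rewrite mxE big1 // => j _; have [jI|Ij] := leqP j I0.
    by rewrite w0 ?mulr0// ii ltnS -I0E.
  by rewrite Lt0 ?mul0r.
have splitI (S : comNzRingType) (F : 'I_n.+1 -> S) :
    \prod_(j < n.+1 | (i0 <= j)%N) F j = F I0 * \prod_(j < n.+1 | (i0 < j)%N) F j.
  have I0ge : (i0 <= I0)%N by rewrite I0E.
  rewrite (bigD1 I0 I0ge); congr (_ * _); apply: eq_bigl => j.
  by rewrite ltn_neqAle -val_eqE -[val I0]/(nat_of_ord I0) I0E eq_sym andbC.
have hE t : h.[t] = \sum_(a : mindex n m | P a && (b ii0 <= a ii0)%N)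
    k a * t ^+ (a ii0 - b ii0) *
    \prod_(j < n.+1 | (i0 < j)%N) ((L *m wt t) j 0) ^+ hexp M a j.
  rewrite /h horner_sum; apply: eq_bigr => a _.
  rewrite !hornerM hornerC hornerXn horner_prod; congr (_ * _); apply: eq_bigr => j _.
  by rewrite horner_exp hornerD hornerM !hornerC hornerX LwtE.
have tailE t : tail M k b i0 (L *m wt t) = t ^+ b ii0 * h.[t].
  rewrite hE mulr_sumr /tail (bigID (fun a : mindex n m => (b ii0 <= a ii0)%N)) /=.
  rewrite [X in _ + X]big1 ?addr0.
    apply: eq_bigr => a /andP[_ ba]; rewrite splitI LwtE Lw0 L1 mul1r add0r.
    rewrite hexp_lift -{1}(subnKC ba) exprD; ring.
  move=> a /andP[/forallP aP]; rewrite -ltnNge => ab; rewrite klt ?mul0r//.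
  by exists ii0; split=> // j ji; apply/eqP; have := aP j; rewrite ji.
(* At [t = 0] only the indices with [a ii0 = b ii0] survive. *)
have h0 : h.[0] = tail M k b i' (L *m w).
  rewrite hE /tail (bigID (fun a : mindex n m => a ii0 == b ii0)) /= addrC big1 ?add0r.
    have wt0 : wt 0 = w by rewrite /wt scale0r addr0.
    apply: eq_big => [a|a /andP[_ /eqP ->]]; last first.
      by rewrite subnn expr0 mulr1 wt0; congr (_ * _); apply: eq_bigl => j; rewrite ii.
    apply/andP/forallP => [[/andP[/forallP Pa _] /eqP aE] j|H].
      rewrite ii ltnS leq_eqVlt; apply/implyP => /orP[/eqP ji|ji]; last first.
        by have := Pa j; rewrite ji.
      by have -> : j = ii0 by [apply: val_inj]; rewrite aE.
    have aE : a ii0 == b ii0 by have := H ii0; rewrite ii /= ltnS leqnn.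
    split=> //; rewrite (eqP aE) leqnn andbT; apply/forallP => j; apply/implyP => ji.
    by have := H j; rewrite ii ltnS (ltnW ji).
  move=> a /andP[/andP[_ ba] nab]; rewrite expr0n subn_eq0 leqNgt ltn_neqAle ba andbT.
  by rewrite eq_sym val_eqE nab /= mulr0 mul0r.
have r0 : 0 <= r I0 by rewrite lecR sqrtr_ge0.
have [t tr th] := max_modulus h r0.
have tsq : sqmod t = rho I0.
  by rewrite -rsq; apply: complexI; rewrite !sqmodE tr ger0_norm.
exists (wt t); split.
- move=> j ji; rewrite !mxE w0 ?ii ?ltnS ?(ltnW ji)// add0r.
  have -> : (j == I0) = false by apply: contraTF ji => /eqP ->; rewrite I0E ltnn.
  by rewrite mulr0.
- move=> j; rewrite leq_eqVlt => /orP[/eqP ji|ij].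
    have -> : j = I0 by apply: val_inj; exact: (etrans (esym ji) (esym I0E)).
    by rewrite !mxE w0 ?ii ?I0E// !eqxx mulr1 add0r.
  rewrite !mxE.
  have -> : (j == I0) = false by apply: contraTF ij => /eqP ->; rewrite I0E ltnn.
  by rewrite mulr0 addr0 wr ?ii.
rewrite tailE splitI sqmodM sqmodX tsq hexp_lift ler_wpM2l ?exprn_ge0//.
rewrite le_normc_sqmod h0 in th; apply: le_trans th; apply: le_trans wge.
by rewrite ii.
Qed.

Lemma torus_point n m M (k : {ffun mindex n m -> C}) (b : mindex n m)
    (L : 'M[C]_n.+1) (rho : 'I_n.+1 -> R) :
  A_set b k -> unitrig L -> (forall j, 0 <= rho j) ->
  exists w : 'cV[C]_n.+1, (forall j, sqmod (w j 0) = rho j) /\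
    \prod_j rho j ^+ hexp M b j <= sqmod (hpeval M k (L *m w)).
Proof.
move=> kb uL rho0; have [w [_ wr wge]] := torus_tail M kb uL rho0 (leq0n n).
exists w; split=> [j|]; first exact: wr.
suff -> : hpeval M k (L *m w) = tail M k b 0 (L *m w) by exact: wge.
by apply: eq_bigl => a; apply/esym/forallP.
Qed.

Lemma hpeval_zvec n m M (k : {ffun mindex n m -> C}) (Z : 'cV[C]_n.+1) :
  is_section k -> (m <= M)%N -> Z ord_max 0 != 0 ->
  hpeval M k Z = Z ord_max 0 ^+ M * peval k (fun i => Z (lift ord_max i) 0 / Z ord_max 0).
Proof.
move=> ks mM Z0; rewrite /hpeval /peval mulr_sumr; apply: eq_bigr => a _.
have [ma|am] := ltnP m (mdeg a); first by rewrite ks// !mul0r mulr0.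
rewrite big_ord_lift_max /= hexp_max [RHS]mulrCA; congr (_ * _).
under eq_bigr do rewrite hexp_lift.
under [in RHS]eq_bigr do rewrite exprMn exprVn.
rewrite big_split /= [RHS]mulrCA; congr (_ * _).
rewrite prodfV prodrXr -/(mdeg a).
have aM := leq_trans am mM.
by rewrite -{2}(subnK aM) exprD mulfK// expf_neq0.
Qed.

Lemma zvec_scale n (Z : 'cV[C]_n.+1) : Z ord_max 0 != 0 ->
  zvec (fun i => Z (lift ord_max i) 0 / Z ord_max 0) = (Z ord_max 0)^-1 *: Z.
Proof.
move=> Z0; apply/matrixP => i j; rewrite ord1 !mxE.
case: unliftP => [l ->|->]; first by rewrite mulrC.
by rewrite mulVf.
Qed.

(** The torus point is rescaled to last coordinate 1. The form equals 1 on the torus, so [q] is the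
    inverse of [|Z_n|^2] and [q ^+ M] accounts exactly for the rescaling. *)
Lemma section_point n m M (k : {ffun mindex n m -> C}) (b : mindex n m)
    (L A : 'M[C]_n.+1) (mu rho : 'I_n.+1 -> R) :
  A_set b k -> (m < M)%N -> unitrig L -> A *m L = 1%:M ->
  (forall j, 0 < rho j) -> \sum_j mu j * rho j = 1 ->
  exists z : 'I_n -> C, let q := \sum_j mu j * sqmod ((A *m zvec z) j 0) in
    0 < q /\ (\prod_j rho j ^+ hexp M b j) * q ^+ M <= sqmod (peval k z).
Proof.
move=> kb mM uL AL rho0 sum1.
have [w [wr wge]] := torus_point M kb uL (fun j => ltW (rho0 j)).
have ks := kb.1; set Z := L *m w in wge.
(* As [m < M], each term with a nonzero coefficient contains a positive power of [Z_n], whereas the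
   value at [Z] is nonzero. *)
have Z0 : Z ord_max 0 != 0.
  apply/eqP => Z0; have : 0 < sqmod (hpeval M k Z).
    by apply: lt_le_trans wge; apply: prodr_gt0 => j _; rewrite exprn_gt0.
  rewrite /hpeval big1 ?sqmod0 ?ltxx// => a _.
  have [ma|am] := ltnP m (mdeg a); first by rewrite ks// mul0r.
  rewrite big_ord_lift_max /= hexp_max Z0 expr0n subn_eq0 leqNgt.
  by rewrite (leq_ltn_trans am mM) /= mulr0 mulr0.
exists (fun i => Z (lift ord_max i) 0 / Z ord_max 0).
have s0 : 0 < sqmod (Z ord_max 0) by rewrite sqmod_gt0.
have -> : \sum_j mu j * sqmod ((A *m zvec (fun i => Z (lift ord_max i) 0 / Z ord_max 0)) j 0)
    = (sqmod (Z ord_max 0))^-1.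
  rewrite zvec_scale// -scalemxAr /Z mulmxA AL mul1mx -[RHS]mulr1 -sum1 mulr_sumr.
  by apply: eq_bigr => j _; rewrite mxE sqmodM sqmodV wr mulrCA.
split; first by rewrite invr_gt0.
rewrite exprVn ler_pdivrMr ?exprn_gt0//; apply: le_trans wge _.
by rewrite hpeval_zvec ?(ltnW mM)// sqmodM sqmodX mulrC.
Qed.

End TorusPoint.

(** * Sections with a prescribed leading term *)

Section LeadingMonomial.
Variable R : realType.
Local Notation C := (complex R).
Variable n : nat.
Implicit Types (a b c d : {ffun 'I_n -> nat}) (z : 'I_n -> C) (F G : ('I_n -> C) -> C).

(** Exponents are unbounded here, unlike in [mindex], so that they can be added freely. *)
Definition lexn a b := exists i : 'I_n, (forall j : 'I_n, (j < i)%N -> a j = b j) /\ (a i < b i)%N.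

Definition addx a b : {ffun 'I_n -> nat} := [ffun i => a i + b i]%N.

Definition degx a : nat := (\sum_i a i)%N.

Definition mon a z : C := \prod_i z i ^+ a i.

Lemma lexn_trans a b c : lexn a b -> lexn b c -> lexn a c.
Proof.
move=> [i [ij iab]] [k [kj kbc]].
have [ik|ki|ik] := ltngtP i k.
- exists i; split=> [j ji|]; first by rewrite ij// kj// (ltn_trans ji).
  by rewrite -kj.
- exists k; split=> [j jk|]; first by rewrite ij ?kj// (ltn_trans jk).
  by rewrite ij.
- have {}ik := val_inj ik; subst k; exists i; split=> [j ji|]; first by rewrite ij// kj.
  exact: ltn_trans iab kbc.
Qed.

Lemma lexn_irr a : ~ lexn a a.
Proof. by move=> [i [_]]; rewrite ltnn. Qed.

Lemma lexn_add2r c a b : lexn a b -> lexn (addx a c) (addx b c).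
Proof.
move=> [i [ij iab]]; exists i; split=> [j ji|]; first by rewrite !ffunE ij.
by rewrite !ffunE ltn_add2r.
Qed.

Lemma addxC a b : addx a b = addx b a.
Proof. by apply/ffunP => i; rewrite !ffunE addnC. Qed.

Lemma lexn_add a b c d : lexn a b -> lexn c d -> lexn (addx a c) (addx b d).
Proof.
move=> ab cd; apply: lexn_trans (lexn_add2r c ab) _.
by rewrite !(addxC b); exact: lexn_add2r.
Qed.

Lemma degx_add a b : degx (addx a b) = (degx a + degx b)%N.
Proof. by rewrite /degx -big_split; apply: eq_bigr => i _; rewrite ffunE. Qed.

Lemma mon_add a b z : mon (addx a b) z = mon a z * mon b z.
Proof. by rewrite /mon -big_split; apply: eq_bigr => i _; rewrite ffunE exprD. Qed.

(** Stated for functions, with the later terms in a list that may repeat exponents; products then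
    need no collection of like terms. *)
Definition leads m a F := (degx a <= m)%N /\
  exists2 s : seq (C * {ffun 'I_n -> nat}),
    (forall u, u \in s -> (degx u.2 <= m)%N /\ lexn a u.2) &
    forall z, F z = mon a z + \sum_(u <- s) u.1 * mon u.2 z.

Lemma leads1 : leads 0 [ffun=> 0%N] (fun=> 1).
Proof.
split; first by rewrite /degx big1// => i _; rewrite ffunE.
exists [::] => // z; rewrite big_nil addr0 /mon big1// => i _.
by rewrite ffunE expr0.
Qed.

Lemma leadsM m1 m2 a b F G : leads m1 a F -> leads m2 b G ->
  leads (m1 + m2) (addx a b) (fun z => F z * G z).
Proof.
move=> [da [s sP FE]] [db [t tP GE]]; split; first by rewrite degx_add leq_add.
exists ([seq (u.1, addx a u.2) | u <- t] ++ [seq (u.1, addx u.2 b) | u <- s] ++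
        [seq (u.1 * v.1, addx u.2 v.2) | u <- s, v <- t]).
  move=> u; rewrite !mem_cat => /or3P[/mapP[v vt ->]|/mapP[v vs ->]|/allpairsP[[v w] [vs wt ->]]] /=.
  - have [dv av] := tP _ vt; rewrite degx_add leq_add//; split=> //.
    by rewrite !(addxC a); exact: lexn_add2r.
  - have [dv av] := sP _ vs; rewrite degx_add leq_add//; split=> //.
    exact: lexn_add2r.
  - have [dv av] := sP _ vs; have [dw aw] := tP _ wt.
    by rewrite degx_add leq_add//; split=> //; exact: lexn_add.
move=> z; rewrite FE GE !big_cat /= !big_map mon_add big_allpairs_dep /=.
rewrite mulrDl !mulrDr mulr_sumr mulr_suml -!addrA; congr (_ + _).
rewrite (eq_bigr (fun u => u.1 * mon (addx a u.2) z)); last first.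
  by move=> u _; rewrite mon_add mulrCA.
congr (_ + _); congr (_ + _); first by apply: eq_bigr => u _; rewrite mon_add mulrA.
rewrite mulr_suml; apply: eq_bigr => u _; rewrite mulr_sumr; apply: eq_bigr => v _.
by rewrite mon_add; ring.
Qed.

Lemma eq_leads m m' a a' F F' : m = m' -> a =1 a' -> F =1 F' ->
  leads m a F -> leads m' a' F'.
Proof.
move=> -> /ffunP -> FF [da [s sP FE]]; split=> //; exists s => // z.
by rewrite -FF FE.
Qed.

Lemma leadsX m a F k : leads m a F ->
  leads (k * m) [ffun i => k * a i]%N (fun z => F z ^+ k).
Proof.
move=> H; elim: k => [|k IH].
  by apply: eq_leads leads1 => // i; rewrite !ffunE.
apply: eq_leads (leadsM H IH) => [|i|z]; first by rewrite mulSn.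
  by rewrite !ffunE mulSn.
by rewrite exprS.
Qed.

Lemma leads_prod I (r : seq I) (e : I -> nat) (E : I -> {ffun 'I_n -> nat})
    (F : I -> ('I_n -> C) -> C) : (forall i, leads 1 (E i) (F i)) ->
  leads (\sum_(i <- r) e i) [ffun l => \sum_(i <- r) e i * E i l]%N
    (fun z => \prod_(i <- r) F i z ^+ e i).
Proof.
move=> H; elim: r => [|i r IH].
  by apply: eq_leads leads1 => [|l|z]; rewrite ?big_nil// !ffunE big_nil.
apply: eq_leads (leadsM (leadsX (e i) (H i)) IH) => [|l|z].
- by rewrite big_cons muln1.
- by rewrite !ffunE big_cons.
- by rewrite big_cons.
Qed.

Definition unitx (j : 'I_n.+1) : {ffun 'I_n -> nat} :=
  [ffun l => (lift ord_max l == j : nat)].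

Lemma mon_unitx j z : mon (unitx j) z = zvec z j 0.
Proof.
rewrite /mon mxE; case: unliftP => [l ->|->].
  rewrite (bigD1 l) //= ffunE eqxx expr1 big1 ?mulr1// => i il.
  by rewrite ffunE (inj_eq (@lift_inj _ _)) (negPf il) expr0.
by rewrite big1// => l _; rewrite ffunE eq_sym (negPf (neq_lift _ _)) expr0.
Qed.

Lemma degx_unitx j : (degx (unitx j) <= 1)%N.
Proof.
rewrite /degx; have [l ->|->] := unliftP ord_max j.
  rewrite (bigD1 l) //= ffunE eqxx big1// => i il.
  by rewrite ffunE (inj_eq (@lift_inj _ _)) (negPf il).
by rewrite big1// => l _; rewrite ffunE eq_sym (negPf (neq_lift _ _)).
Qed.

(** Coordinates of smaller index come later in the order, and the constant coordinate comes first.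
    So row [i] of a lower unitriangular matrix has the [i]-th coordinate as leading term. *)
Lemma lexn_unitx (i j : 'I_n.+1) : (j < i)%N -> lexn (unitx i) (unitx j).
Proof.
move=> ji; have jn : (j < n)%N by rewrite (leq_trans ji)// -ltnS ltn_ord.
pose l := Ordinal jn; have lE : lift ord_max l = j.
  by apply: val_inj; rewrite /= /bump leqNgt jn.
have liftE (k : 'I_n) (h : 'I_n.+1) : (lift ord_max k == h) = (k == h :> nat).
  by rewrite -val_eqE /= /bump leqNgt ltn_ord.
exists l; split=> [k kl|].
  have kj : (k < j)%N by [].
  by rewrite !ffunE !liftE !ltn_eqF// (ltn_trans kj).
by rewrite !ffunE !liftE eqxx ltn_eqF.
Qed.

Lemma leads_trig (A : 'M[C]_n.+1) i : unitrig A ->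
  leads 1 (unitx i) (fun z => (A *m zvec z) i 0).
Proof.
move=> [At A1]; split; first exact: degx_unitx.
exists [seq (A i j, unitx j) | j in [pred j : 'I_n.+1 | (j < i)%N]].
  move=> u /fintype.imageP[j ji uE]; rewrite {}uE /=.
  by split; [exact: degx_unitx|exact: lexn_unitx].
move=> z; rewrite big_image /= mon_unitx mxE.
rewrite (bigD1 i) //= A1 mul1r; congr (_ + _).
rewrite (bigID (fun j : 'I_n.+1 => (j < i)%N)) /= [X in _ + X]big1 ?addr0.
  apply: eq_big => [j|j _]; last by rewrite mon_unitx.
  by rewrite /= inE; have [->|] := eqVneq j i; rewrite ?ltnn.
move=> j; rewrite -leqNgt -val_eqE /= => /andP[ji ij].
by move/is_trig_mxP : At => ->; rewrite ?mul0r// ltn_neqAle eq_sym ji.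
Qed.

Lemma leads_section m (b : mindex n m) F : leads m [ffun i => b i : nat] F ->
  exists2 k : {ffun mindex n m -> C}, A_set b k & forall z, peval k z = F z.
Proof.
move=> [db [s sP FE]].
(* The truncation by [inord] is harmless because every exponent is at most the degree, hence at most
   [m]. *)
pose ix (a : {ffun 'I_n -> nat}) : mindex n m := [ffun i => inord (a i)].
have ixE a : (degx a <= m)%N -> forall i, ix a i = a i :> nat.
  move=> am i; rewrite ffunE inordK// ltnS (leq_trans _ am)// /degx (bigD1 i)//=.
  exact: leq_addr.
have mdegb : (mdeg b <= m)%N by move: db; rewrite /degx; under eq_bigr do rewrite ffunE.
pose k : {ffun mindex n m -> C} :=
  [ffun a => (a == b)%:R + \sum_(u <- s) (ix u.2 == a)%:R * u.1].
have k0 (a : mindex n m) : a != b -> (forall u, u \in s -> ix u.2 != a) -> k a = 0.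
  move=> ab H; rewrite ffunE (negPf ab) add0r big_seq big1// => u us.
  by rewrite (negPf (H u us)) mul0r.
exists k; [split; last split|].
- move=> a ma; apply: k0.
    by apply: contraTneq ma => ->; rewrite -leqNgt.
  move=> u /sP[du _]; apply: contraTneq ma => <-; rewrite -leqNgt.
  by rewrite /mdeg; under eq_bigr do rewrite ixE//.
- rewrite ffunE eqxx big_seq big1 ?addr0// => u /sP[du lu].
  have [ub|] := eqVneq (ix u.2) b; last by rewrite mul0r.
  exfalso; apply: (@lexn_irr u.2); move: lu; congr lexn.
  by apply/ffunP => i; rewrite ffunE -ub ixE.
- move=> a [i [ij iab]]; apply: k0.
    by apply: contraTneq iab => ->; rewrite ltnn.
  move=> u /sP[du lu]; apply/eqP => ua.
  apply: (@lexn_irr u.2); apply: lexn_trans lu.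
  exists i; split=> [j ji|]; first by rewrite !ffunE -ij// -ua ixE.
  by rewrite !ffunE -(ixE _ du) ua.
move=> z; rewrite FE /peval.
under eq_bigr do rewrite ffunE mulrDl mulr_suml.
rewrite big_split /=; congr (_ + _).
  rewrite (bigD1 b) //= eqxx mul1r [X in _ + X]big1 ?addr0; last first.
    by move=> a /negPf ->; rewrite mul0r.
  by apply: eq_bigr => i _; rewrite ffunE.
rewrite exchange_big /= big_seq [RHS]big_seq; apply: eq_bigr => u /sP[du _].
rewrite (bigD1 (ix u.2)) //= eqxx mul1r [X in _ + X]big1 ?addr0; last first.
  by move=> a; rewrite eq_sym => /negPf ->; rewrite !mul0r.
by congr (_ * _); apply: eq_bigr => i _; rewrite ixE.
Qed.

Lemma section_exists m (b : mindex n m) (A : 'M[C]_n.+1) :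
  (mdeg b <= m)%N -> unitrig A ->
  exists2 k : {ffun mindex n m -> C}, A_set b k &
    forall z, peval k z = \prod_i (A *m zvec z) i 0 ^+ hexp m b i.
Proof.
move=> bm uA; apply: leads_section.
apply: eq_leads (leads_prod _ (hexp m b) (fun i => leads_trig i uA)) => [|l|z //].
  exact: sum_hexp.
rewrite !ffunE (bigD1 (lift ord_max l)) //= ffunE eqxx muln1 hexp_lift big1 ?addn0//.
by move=> i; rewrite ffunE eq_sym => /negPf ->; rewrite muln0.
Qed.

End LeadingMonomial.

(** * Bounds for the Chebyshev norms *)

Section ChebyshevBounds.
Variable R : realType.
Local Notation C := (complex R).

Lemma mulmx_sqmod_le p q (B : 'M[C]_(p, q)) : exists2 c : R, 0 < c &
  forall w : 'cV[C]_q, \sum_i sqmod ((B *m w) i 0) <= c * \sum_j sqmod (w j 0).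
Proof.
exists (1 + \sum_i \sum_j q%:R * sqmod (B i j)).
  by rewrite ltr_pwDl// sumr_ge0// => i _; rewrite sumr_ge0// => j _; rewrite mulr_ge0// sqmod_ge0.
move=> w; rewrite mulrDl mul1r -[leLHS]add0r lerD//.
  by rewrite sumr_ge0// => j _; rewrite sqmod_ge0.
rewrite mulr_suml; apply: ler_sum => i _; rewrite mxE.
apply: le_trans (sqmod_sum_le _) _; rewrite mulr_sumr mulr_suml; apply: ler_sum => j _.
rewrite sqmodM mulrA ler_wpM2l ?mulr_ge0 ?sqmod_ge0//.
by rewrite (bigD1 j) //= lerDl sumr_ge0// => l _; rewrite sqmod_ge0.
Qed.

Lemma sum_weight_le q (mu : 'I_q -> R) : (forall i, 0 < mu i) ->
  exists2 c : R, 0 < c & forall x : 'I_q -> R, (forall i, 0 <= x i) ->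
    \sum_i x i <= c * (\sum_i mu i * x i) /\ \sum_i mu i * x i <= c * \sum_i x i.
Proof.
move=> mu0; exists (1 + \sum_i ((mu i)^-1 + mu i)).
  by rewrite ltr_pwDl// sumr_ge0// => i _; rewrite addr_ge0// ?invr_ge0 ltW.
move=> x x0.
have cle i : (mu i)^-1 + mu i <= 1 + \sum_i ((mu i)^-1 + mu i).
  rewrite (bigD1 i) //= addrCA lerDl addr_ge0// sumr_ge0// => j _.
  by rewrite addr_ge0// ?invr_ge0 ltW.
rewrite !mulr_sumr; split; apply: ler_sum => i _.
  rewrite mulrA -[leLHS]mul1r ler_wpM2r//; apply: (@le_trans _ _ ((mu i)^-1 * mu i)).
    by rewrite mulVf ?gt_eqF.
  rewrite ler_wpM2r ?(ltW (mu0 i))//.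
  by apply: le_trans (cle i); rewrite lerDl ltW.
by rewrite ler_wpM2r//; apply: le_trans (cle i); rewrite lerDr invr_ge0 ltW.
Qed.

Section FubiniStudy.
Variables (n : nat) (P L A : 'M[C]_n.+1) (mu : 'I_n.+1 -> R).
Hypotheses (uL : unitrig L) (uA : unitrig A) (AL : A *m L = 1%:M).
Hypothesis mu0 : forall i, 0 < mu i.
Hypothesis PE : forall v : 'cV[C]_n.+1,
  complex.Re ((conjT v *m P *m v) 0 0) = \sum_i mu i * sqmod ((A *m v) i 0).

Let Q (z : 'I_n -> C) : R := \sum_i mu i * sqmod ((A *m zvec z) i 0).

Let sqmod_zvec (z : 'I_n -> C) :
  \sum_i sqmod (zvec z i 0) = 1 + \sum_i sqmod (z i).
Proof.
rewrite big_ord_lift_max /= !mxE unlift_none sqmod1 addrC; congr (_ + _).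
by apply: eq_bigr => i _; rewrite mxE liftK.
Qed.

(** Since [zvec z] is recovered from [A *m zvec z] by applying [L], its norm is controlled by the
    form. This compares the volume density with a power of the form. *)
Lemma fsquad_ge : exists2 c : R, 0 < c & forall z, c * (1 + \sum_i sqmod (z i)) <= Q z.
Proof.
have [c1 c10 H1] := mulmx_sqmod_le L; have [c2 c20 H2] := sum_weight_le mu0.
exists (c1 * c2)^-1; first by rewrite invr_gt0 mulr_gt0.
move=> z; rewrite mulrC ler_pdivrMr ?mulr_gt0// -sqmod_zvec.
have LA := mulmx1C AL.
have -> : zvec z = L *m (A *m zvec z) by rewrite mulmxA LA mul1mx.
rewrite [leRHS]mulrC -mulrA; apply: le_trans (H1 _) _; rewrite ler_wpM2l ?(ltW c10)//.
have [] := H2 (fun i => sqmod ((A *m zvec z) i 0)) (fun i => sqmod_ge0 _).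
by [].
Qed.

Lemma fsquad_gt0 z : 0 < Q z.
Proof.
have [c c0 H] := fsquad_ge; apply: lt_le_trans (H z); rewrite mulr_gt0//.
by rewrite ltr_pwDl// sumr_ge0// => i _; rewrite sqmod_ge0.
Qed.

(** [sqmodD_le] in each diagonal coordinate gives an additive error bounded by a multiple of
    [|z - z'|^2]; the positive lower bound on [Q] makes it multiplicative. *)
Lemma fsquad_shift_le : exists2 K : R, 1 <= K & forall (e : R) z z', 0 < e ->
  Q z <= (1 + e) * Q z' * (1 + K / e * \sum_i sqmod (z i - z' i)).
Proof.
have [c c0 Hc] := fsquad_ge.
have [c1 c10 H1] := mulmx_sqmod_le A; have [c2 c20 H2] := sum_weight_le mu0.
exists (1 + c2 * c1 / c); first by rewrite lerDl divr_ge0 ?mulr_ge0 ?ltW.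
move=> e z z' e0; set S := \sum_i sqmod (z i - z' i).
have S0 : 0 <= S by rewrite sumr_ge0// => i _; rewrite sqmod_ge0.
have uE : \sum_i sqmod ((zvec z - zvec z') i 0) = S.
  rewrite big_ord_lift_max /= !mxE unlift_none subrr sqmod0 addr0.
  by apply: eq_bigr => i _; rewrite !mxE liftK.
have h1 : \sum_i mu i * sqmod ((A *m (zvec z - zvec z')) i 0) <= c2 * c1 * S.
  have [_ h] := H2 (fun i => sqmod ((A *m (zvec z - zvec z')) i 0)) (fun i => sqmod_ge0 _).
  by apply: le_trans h _; rewrite -mulrA ler_wpM2l ?(ltW c20)// -uE.
have h2 : Q z <= (1 + e) * Q z' + (1 + e^-1) * (c2 * c1 * S).
  apply: (@le_trans _ _ ((1 + e) * Q z' +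
      (1 + e^-1) * \sum_i mu i * sqmod ((A *m (zvec z - zvec z')) i 0))); last first.
    by rewrite lerD2l ler_wpM2l// addr_ge0// invr_ge0 ltW.
  rewrite /Q !mulr_sumr -big_split /=; apply: ler_sum => i _.
  rewrite 2![_ * (mu i * _)]mulrCA -mulrDr ler_wpM2l ?(ltW (mu0 i))//.
  have -> : (A *m zvec z) i 0 = (A *m zvec z') i 0 + (A *m (zvec z - zvec z')) i 0.
    by rewrite mulmxBr; move: (A *m _) (A *m _) => u v; rewrite !mxE subrKC.
  exact: sqmodD_le.
have cQ : c <= Q z'.
  apply: le_trans (Hc z'); rewrite ler_peMr ?(ltW c0)// lerDl sumr_ge0// => i _.
  exact: sqmod_ge0.
apply: le_trans h2 _; rewrite [leRHS]mulrDr mulr1 lerD2l.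
have -> : (1 + e^-1) * (c2 * c1 * S) = (1 + e) * c * (c2 * c1 / c / e * S).
  by field; rewrite !gt_eqF.
apply: ler_pM.
- by rewrite mulr_ge0 ?(ltW c0)// addr_ge0// ltW.
- by rewrite mulr_ge0// !divr_ge0 ?mulr_ge0 ?ltW.
- by rewrite ler_wpM2l// addr_ge0// ltW.
by rewrite ler_wpM2r// ler_wpM2r ?invr_ge0 ?(ltW e0)// lerDr.
Qed.

Lemma exp_phiFS m z : expR (- (m%:R * phiFS P z)) = (Q z ^+ m)^-1.
Proof.
by rewrite /phiFS PE -/(Q z) expRN expRM_natl lnK// posrE fsquad_gt0.
Qed.

Variable rho : ('I_n -> C) -> R.

Lemma sum_of_seq (s : seq C) : size s = n ->
  \sum_(i < n) sqmod (of_seq s i) = \sum_(z <- s) sqmod z.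
Proof. by move=> sn; rewrite (big_nth 0) big_mkord sn. Qed.

(** Gibbs' inequality in exponential form: [y i <= expR (y i - 1)], and the sum of [h i * (y i - 1)]
    is [m - m = 0]. *)
Lemma weighted_monomial_le (m : nat) (h : 'I_n.+1 -> nat) z : (0 < m)%N ->
  (forall i, (0 < h i)%N) -> (\sum_i h i)%N = m ->
  \prod_i sqmod ((A *m zvec z) i 0) ^+ h i / Q z ^+ m <=
  \prod_i ((h i)%:R / m%:R / mu i) ^+ h i.
Proof.
move=> m0 h0 hm; have Q0 := fsquad_gt0 z.
have mR : 0 < m%:R :> R by rewrite ltr0n.
have hR i : 0 < (h i)%:R :> R by rewrite ltr0n.
pose y i := mu i * sqmod ((A *m zvec z) i 0) / Q z / ((h i)%:R / m%:R).
have y0 i : 0 <= y i.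
  by rewrite !divr_ge0 ?mulr_ge0 ?sqmod_ge0 ?(ltW (mu0 i))// ltW.
have -> : \prod_i sqmod ((A *m zvec z) i 0) ^+ h i / Q z ^+ m =
    \prod_i ((h i)%:R / m%:R / mu i) ^+ h i * \prod_i y i ^+ h i.
  have -> : Q z ^+ m = \prod_i Q z ^+ h i by rewrite prodrXr hm.
  rewrite -prodfV -!big_split /=; apply: eq_bigr => i _.
  rewrite -exprVn -!exprMn; congr (_ ^+ _); rewrite /y; field.
  by rewrite !gt_eqF.
rewrite -[leRHS]mulr1 ler_wpM2l//.
  by rewrite prodr_ge0// => i _; rewrite exprn_ge0// divr_ge0// ltW.
apply: (@le_trans _ _ (\prod_i expR ((h i)%:R * (y i - 1)))).
  apply: ler_prod => i _; rewrite exprn_ge0//= expRM_natl lerXn2r ?nnegrE ?expR_ge0//.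
  by have := expR_ge1Dx (y i - 1); rewrite addrC subrK.
rewrite -expR_sum -[leRHS]expR0 ler_expR.
rewrite (eq_bigr (fun i => m%:R / Q z * (mu i * sqmod ((A *m zvec z) i 0)) - (h i)%:R)).
  by rewrite sumrB -mulr_sumr -/(Q z) divfK ?gt_eqF// -natr_sum hm subrr.
by move=> i _; rewrite /y; field; rewrite !gt_eqF.
Qed.

Lemma cheb_norm2_le (c : R) m (b : mindex n m) : 0 <= c ->
  (forall z, 0 <= rho z <= c * fs_density z) -> (0 < m)%N -> (mdeg b <= m)%N ->
  (forall i, (0 < hexp m b i)%N) ->
  exists2 k, A_set b k & (L2norm2 P rho k <=
    (c * (pi ^+ 2) ^+ n * \prod_i ((hexp m b i)%:R / m%:R / mu i) ^+ hexp m b i)%:E)%E.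
Proof.
move=> c0 rhoP m0 bm h0; have [k kb kE] := section_exists bm uA; exists k => //.
set U := \prod_i _; have U0 : 0 <= U.
  by rewrite prodr_ge0// => i _; rewrite exprn_ge0// !divr_ge0// ltW.
have cU : 0 <= c * U by rewrite mulr_ge0.
have -> : c * (pi ^+ 2) ^+ n * U = c * U * (pi ^+ 2) ^+ n / 1 ^+ 1 by rewrite divr1 mulrAC.
apply: le_trans (iint_invr_sqmod_le n 0 cU ltr01).
have F0 z : 0 <= sqmod (peval k z) * expR (- (m%:R * phiFS P z)) * rho z.
  by rewrite !mulr_ge0 ?sqmod_ge0 ?expR_ge0//; case/andP: (rhoP z).
apply: le_iint => s; first by rewrite lee_fin.
move=> sn; rewrite lee_fin exp_phiFS kE sqmod_prod addn1.
under eq_bigr do rewrite sqmodX.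
have -> : c * U / (1 + \sum_(z <- s) sqmod z) ^+ n.+1 = U * (c * fs_density (@of_seq R n s)).
  by rewrite /fs_density sum_of_seq// mulrA (mulrC U).
have /andP[r0 rc] := rhoP (@of_seq R n s); apply: ler_pM => //.
  by rewrite divr_ge0 ?exprn_ge0 ?(ltW (fsquad_gt0 _))// prodr_ge0// => i _; rewrite exprn_ge0 ?sqmod_ge0.
exact: weighted_monomial_le (sum_hexp bm).
Qed.

Lemma sep_poly_peval m (k : {ffun mindex n m -> C}) d : (m <= d)%N ->
  sep_poly d (fun s => peval k (@of_seq R n s)).
Proof.
move=> md s1 s2; pose x (i : 'I_n) := of_seq (s1 ++ 0 :: s2) i.
(* A sum over at most one index: it gives exponent 0 when the chosen position lies beyond the [n]
   coordinates. *)
pose e (a : mindex n m) : nat := (\sum_(i < n | i == size s1 :> nat) a i)%N.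
have em a : (e a <= m)%N.
  rewrite /e; have [h|h] := ltnP (size s1) n.
    by rewrite (big_pred1 (Ordinal h)) ?leq_ord// => i; rewrite -val_eqE.
  by rewrite big_pred0// => i; rewrite ltn_eqF// (leq_trans _ h).
exists (\sum_a (k a * \prod_(i < n | i != size s1 :> nat) x i ^+ a i)%:P * 'X^(e a)).
  apply: (leq_trans (size_sum _ _ _)); apply/bigmax_leqP => a _.
  rewrite mul_polyC; apply: leq_trans (size_scale_leq _ _) _.
  by rewrite size_polyXn ltnS (leq_trans (em a)).
move=> z; rewrite horner_sum; apply: eq_bigr => a _.
rewrite hornerM hornerC hornerXn -mulrA; congr (_ * _).
rewrite (bigID (fun i : 'I_n => i == size s1 :> nat)) /= mulrC; congr (_ * _).
  apply: eq_bigr => i is1; congr (_ ^+ _); rewrite /x /of_seq !nth_cat.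
  by case: ltngtP is1 => // i1 _; rewrite -(subnSK i1).
rewrite /e -prodrXr; apply: eq_bigr => i /eqP is1; congr (_ ^+ _).
by rewrite /of_seq nth_cat is1 ltnn subnn.
Qed.

Lemma cheb_norm2_ge (c : R) (alpha : 'I_n.+1 -> R) : 0 < c ->
  (forall z, c * fs_density z <= rho z) -> (forall i, 0 < alpha i) -> \sum_i alpha i = 1 ->
  exists c' D : R, [/\ 0 < c', 0 < D & forall m (b : mindex n m) k, (0 < m)%N -> A_set b k ->
    ((c' * \prod_i (alpha i / mu i) ^+ hexp (m + n.+1) b i / (D * m%:R ^+ 3) ^+ n)%:E <=
     L2norm2 P rho k)%E].
Proof.
move=> c0 rhoP a0 asum.
have [cQ cQ0 HQ] := fsquad_ge; have [K0 K01 HK] := fsquad_shift_le.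
(* The 4 bounds [(1 + 1/M) ^+ M]. In [D], both [M] and [M.+1] are at most [n.+3 * m], and three such
   factors occur, one of them in [K = K0 * M]. *)
pose c' := c * cQ ^+ n.+1 / 4; pose D := 2 ^+ 11 * K0 * n.+3%:R ^+ 3.
have K00 : 0 < K0 by apply: lt_le_trans K01.
have c'0 : 0 < c' by rewrite divr_gt0// mulr_gt0// exprn_gt0.
have D0 : 0 < D by rewrite !mulr_gt0 ?exprn_gt0.
exists c', D; split=> // m b k m0 kb; pose M := (m + n.+1)%N; rewrite -/M.
have ar0 i : 0 < alpha i / mu i by rewrite divr_gt0.
have sum1 : \sum_i mu i * (alpha i / mu i) = 1.
  by rewrite -asum; apply: eq_bigr => i _; rewrite mulrC divfK// gt_eqF.
have mM : (m < M)%N by rewrite -addn1 leq_add.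
have [z1] := section_point kb mM uL AL ar0 sum1.
rewrite /= -/(Q z1); set q := Q z1; set V := \prod_i _ => -[q0 qV].
have V0 : 0 <= V by rewrite prodr_ge0// => i _; rewrite exprn_ge0// ltW.
pose a : seq C := [seq z1 i | i <- enum 'I_n].
have sa : size a = n by rewrite size_map size_enum_ord.
have aE : @of_seq R n a = z1.
  by apply/funext => i; rewrite /of_seq (nth_map i) ?size_enum_ord// nth_ord_enum.
pose K := K0 * M%:R.
have M1 : 1 <= M%:R :> R by rewrite ler1n (leq_trans _ mM).
have M0 : 0 < M%:R :> R by apply: lt_le_trans M1.
have K1 : 1 <= K by rewrite -[leLHS]mulr1 ler_pM.
have K_gt0 : 0 < K by apply: lt_le_trans K1.
pose B := c' / q ^+ M; have B0 : 0 <= B by rewrite divr_ge0 ?exprn_ge0 ?ltW.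
have ME : M = (m + n).+1 by rewrite /M addnS.
have := iint_weighted_lower (M := m + n) K1 erefl B0 sa
  (@sep_poly_peval m k (m + n).+1 (leqW (leq_addr n m))).
rewrite -ME aE; set D' := 2 ^+ 11 * K * (M * M.+1)%:R => H.
apply: (@le_trans _ _ (B * sqmod (peval k z1) / D' ^+ n)%:E).
  rewrite lee_fin.
  have M0n : (0 < M)%N by rewrite ME.
  have D'0 : 0 < D' by rewrite mulr_gt0 ?ltr0n ?muln_gt0 ?M0n// mulr_gt0// exprn_gt0.
  have DD : D' <= D * m%:R ^+ 3.
    rewrite /D' /D /K natrM.
    have Mle : M%:R <= n.+3%:R * m%:R :> R.
      by rewrite -natrM ler_nat mulSn leq_add2l (leq_trans (leqnSn _))// leq_pmulr.
    have Mle1 : M.+1%:R <= n.+3%:R * m%:R :> R.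
      by rewrite -natrM ler_nat mulSn -addnS leq_add2l leq_pmulr.
    have -> : 2 ^+ 11 * (K0 * M%:R) * (M%:R * M.+1%:R) =
      (2 ^+ 11 * K0) * (M%:R * M%:R * M.+1%:R) :> R by ring.
    have -> : 2 ^+ 11 * K0 * n.+3%:R ^+ 3 * m%:R ^+ 3 =
      (2 ^+ 11 * K0) * ((n.+3%:R * m%:R) * (n.+3%:R * m%:R) * (n.+3%:R * m%:R)) :> R by ring.
    rewrite ler_wpM2l ?mulr_ge0 ?exprn_ge0 ?(ltW K00)//.
    by apply: ler_pM; rewrite ?mulr_ge0// ler_pM.
  apply: ler_pM.
  - by rewrite mulr_ge0// ltW.
  - by rewrite invr_ge0 exprn_ge0// mulr_ge0 ?exprn_ge0// ltW.
  - rewrite /B -mulrA ler_wpM2l ?(ltW c'0)// mulrC ler_pdivlMr ?exprn_gt0//.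
  - rewrite lef_pV2 ?posrE; last 2 first.
    + by rewrite exprn_gt0// mulr_gt0// exprn_gt0// ltr0n.
    + exact: exprn_gt0.
    have D'0' := ltW D'0; by rewrite lerXn2r// nnegrE// (le_trans _ DD).
apply: le_trans H _; apply: le_iint => s.
  rewrite lee_fin; apply: divr_ge0; first by rewrite mulr_ge0 ?sqmod_ge0.
  apply: prodr_ge0 => u _.
  by rewrite exprn_ge0// addr_ge0// mulr_ge0 ?sqmod_ge0// ltW.
move=> sn; rewrite lee_fin exp_phiFS; set x := @of_seq R n s.
set W := \prod_(u <- zip s a) _.
have w0 (u : C * C) : 1 <= 1 + K * sqmod (u.1 - u.2).
  by rewrite lerDl mulr_ge0 ?sqmod_ge0// ltW.
have W0 : 0 < W by rewrite prodr_gt0// => u _; rewrite exprn_gt0// (lt_le_trans _ (w0 u)).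
have Qx0 := fsquad_gt0 x; have Q_ge0 := ltW Qx0.
have QX : Q x ^+ M <= 4 * q ^+ M * W.
  have h : Q x <= (1 + M%:R^-1) * q * \prod_(u <- zip s a) (1 + K * sqmod (u.1 - u.2)).
    have iM0 : 0 < M%:R^-1 :> R by rewrite invr_gt0.
    apply: le_trans (HK _ x z1 iM0) _; rewrite invrK -/K.
    rewrite ler_wpM2l ?mulr_ge0 ?(ltW q0) ?addr_ge0 ?(ltW iM0)//.
    have -> : \sum_i sqmod (x i - z1 i) = \sum_(u <- zip s a) sqmod (u.1 - u.2).
      rewrite (big_nth (0, 0)) size_zip sn sa minnn big_mkord; apply: eq_bigr => i _.
      by rewrite nth_zip ?sn ?sa// -aE.
    (* One plus a sum is at most the product of the [1 + K * sqmod (u.1 - u.2)], which separates the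
       variables. *)
    elim: (zip s a) => [|u r IH]; first by rewrite !big_nil mulr0 addr0.
    rewrite !big_cons; apply: le_trans (ler_wpM2l _ IH); last first.
      by rewrite (le_trans _ (w0 u)).
    set S := \sum_(v <- r) _; have S0 : 0 <= S by rewrite sumr_ge0// => v _; rewrite sqmod_ge0.
    have -> : (1 + K * sqmod (u.1 - u.2)) * (1 + K * S) =
      1 + K * (sqmod (u.1 - u.2) + S) + (K * sqmod (u.1 - u.2)) * (K * S) by ring.
    have K_ge0 := ltW K_gt0; rewrite lerDl.
    by apply: mulr_ge0; apply: mulr_ge0 => //; exact: sqmod_ge0.
  apply: (@le_trans _ _ (((1 + M%:R^-1) * q *
      \prod_(u <- zip s a) (1 + K * sqmod (u.1 - u.2))) ^+ M)).
    by rewrite lerXn2r// nnegrE// (le_trans _ h).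
  rewrite !exprMn -prodrXl ler_wpM2r ?(ltW W0)// ler_wpM2r ?exprn_ge0 ?(ltW q0)//.
  by rewrite ME expr1DV_le4.
have S0 : 0 < 1 + \sum_i sqmod (x i).
  by rewrite ltr_pwDl// sumr_ge0// => i _; rewrite sqmod_ge0.
(* The density contributes the [n.+1] additional powers of [Q] that raise the exponent from [m] to
   [M]. *)
have rx : c * cQ ^+ n.+1 / Q x ^+ n.+1 <= rho x.
  apply: le_trans (rhoP x); rewrite -mulrA ler_wpM2l ?(ltW c0)// /fs_density.
  rewrite ler_pdivrMr ?exprn_gt0// mulrC -[leRHS]/(Q x ^+ n.+1 / _) ler_pdivlMr ?exprn_gt0//.
  by rewrite -exprMn lerXn2r ?nnegrE ?mulr_ge0 ?(ltW cQ0) ?(ltW Qx0) ?(ltW S0)// HQ.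
apply: (@le_trans _ _ (sqmod (peval k x) / Q x ^+ m * (c * cQ ^+ n.+1 / Q x ^+ n.+1))); last first.
  by rewrite ler_wpM2l// divr_ge0 ?sqmod_ge0// exprn_ge0// ltW.
have -> : sqmod (peval k x) / Q x ^+ m * (c * cQ ^+ n.+1 / Q x ^+ n.+1) =
    sqmod (peval k x) * (c * cQ ^+ n.+1) / Q x ^+ M.
  by rewrite /M exprD; field; rewrite !expf_neq0 ?gt_eqF.
have -> : B * sqmod (peval k x) / W =
    sqmod (peval k x) * (c * cQ ^+ n.+1) / (4 * q ^+ M * W).
  by rewrite /B /c'; field; rewrite (gt_eqF W0) expf_neq0 ?gt_eqF.
apply: ler_wpM2l.
  by rewrite mulr_ge0 ?sqmod_ge0// mulr_ge0 ?(ltW c0)// exprn_ge0// ltW.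
rewrite lef_pV2// posrE; last exact: exprn_gt0.
by rewrite mulr_gt0// mulr_gt0// exprn_gt0.
Qed.

End FubiniStudy.
End ChebyshevBounds.

(** * Passage to the limit *)

Section Limits.
Variable R : realType.

Lemma ln_prodX (I : Type) (r : seq I) (x : I -> R) (h : I -> nat) :
  (forall i, 0 < x i) ->
  ln (\prod_(i <- r) x i ^+ h i) = \sum_(i <- r) (h i)%:R * ln (x i).
Proof.
move=> x0; elim: r => [|i r IH]; first by rewrite !big_nil ln1.
rewrite !big_cons lnM ?posrE ?exprn_gt0// ?IH; last first.
  by apply: prodr_gt0 => j _; exact: exprn_gt0.
by rewrite lnXn// mulr_natl.
Qed.

Lemma cvg_sumr (I : Type) (r : seq I) (u : I -> nat -> R) (a : I -> R) :
  (forall i, u i k @[k --> \oo] --> a i) ->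
  \sum_(i <- r) u i k @[k --> \oo] --> \sum_(i <- r) a i.
Proof.
by move=> H; apply: cvg_big => //; exact: add_continuous.
Qed.

Lemma cvg_inv_incr (m : nat -> nat) : (forall k, (m k < m k.+1)%N) ->
  (m k)%:R^-1 @[k --> \oo] --> (0 : R).
Proof.
move=> hm; have mk k : (k <= m k)%N by elim: k => // k IH; exact: leq_ltn_trans IH (hm k).
have : ((m k)%:R : R) @[k --> \oo] --> +oo%R.
  apply/(@cvgrnyP R); apply/cvgnyPge => A; near=> k.
  by apply: leq_trans (mk k); near: k; exact: nbhs_infty_ge.
move=> h; apply/(gtr0_cvgV0 _).2 => //; near=> k.
rewrite ltr0n; apply: leq_trans (mk k); near: k; exact: nbhs_infty_ge.
Unshelve. all: by end_near. Qed.

(** With [t] the inverse square root of [m], [ln m] is [2 * ln t^-1], which is less than [2 / t]. *)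
Lemma ln_nat_le (m : nat) : (0 < m)%N ->
  0 <= m%:R^-1 * ln (m%:R : R) <= 2 * Num.sqrt (m%:R^-1).
Proof.
move=> m0; have mR : 0 < m%:R :> R by rewrite ltr0n.
rewrite mulr_ge0 ?invr_ge0 ?ln_ge0 ?ler1n//=.
set t := Num.sqrt _; have t0 : 0 < t by rewrite sqrtr_gt0 invr_gt0.
have tE : m%:R^-1 = t ^+ 2 by rewrite sqr_sqrtr// invr_ge0 ltW.
have -> : m%:R = (t^-1) ^+ 2 :> R by rewrite exprVn -tE invrK.
rewrite lnXn ?invr_gt0// exprVn invrK mulr2n.
have : ln t^-1 < t^-1 by apply: ln_sublinear; rewrite invr_gt0.
move=> h; have := ler_wpM2l (sqr_ge0 t) (ltW h).
have -> : t ^+ 2 / t = t by field; rewrite gt_eqF.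
by lra.
Qed.

Lemma cvg_inv_ln_incr (m : nat -> nat) : (forall k, (m k < m k.+1)%N) ->
  (m k)%:R^-1 * ln (m k)%:R @[k --> \oo] --> (0 : R).
Proof.
move=> hm; have h := cvg_inv_incr hm.
apply: (@squeeze_cvgr _ _ _ _ (fun=> 0) (fun k => 2 * Num.sqrt ((m k)%:R^-1))).
- near=> k; apply: ln_nat_le.
  have mk l : (l <= m l)%N by elim: l => // l IH; exact: leq_ltn_trans IH (hm l).
  by apply: leq_trans (mk k); near: k; exact: nbhs_infty_ge.
- exact: cvg_cst.
rewrite -[X in _ --> X](mulr0 2); apply: cvgM; first exact: cvg_cst.
rewrite -[X in _ --> X]sqrtr0.
by apply: (cvg_comp _ _ h); exact: sqrt_continuous.
Unshelve. all: by end_near. Qed.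

(** The two real bounds force the infimum to be finite, so [fine] returns its actual value. *)
Lemma le_fine_ereal_inf (S : set \bar R) (lo up : R) :
  (forall x, S x -> lo%:E <= x)%E -> (exists2 x, S x & (x <= up%:E)%E) ->
  lo <= fine (ereal_inf S) <= up.
Proof.
move=> Slo [x Sx xup].
have h1 : (lo%:E <= ereal_inf S)%E by apply: le_ereal_inf_tmp => y /Slo.
have h2 : (ereal_inf S <= up%:E)%E by apply: le_trans xup; exact: ereal_inf_lbound.
have hf : ereal_inf S \is a fin_num.
  by rewrite fin_numElt (lt_le_trans _ h1) ?ltNyr// (le_lt_trans h2) ?ltry.
by rewrite -!lee_fin fineK// h1.
Qed.

End Limits.

Theorem theorem1p2 (R : realType) (n : nat) (hn : (1 <= n)%N)
    (P : 'M[complex R]_n.+1) (hP : hermitian_pd P)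
    (rho : ('I_n -> complex R) -> R) (hrho : admissible_density rho)
    (alpha : 'I_n -> R)
    (halpha_pos : forall i, 0 < alpha i)
    (halpha_sum : \sum_(i < n) alpha i < 1)
    (m : nat -> nat) (hm : forall k, (m k < m k.+1)%N)
    (beta : forall k, mindex n (m k))
    (hbeta : forall k, (mdeg (beta k) <= m k)%N)
    (hconv : forall i : 'I_n,
        (fun k => ((beta k i : nat)%:R / (m k)%:R : R)) @ \oo --> alpha i) :
  (fun k => (m k)%:R^-1 * ln (cheb_norm2 P rho (beta k))) @ \oo -->
    (\sum_(i < n) alpha i * ln (alpha i / mu_ P i)
     + (1 - \sum_(i < n) alpha i)
       * ln ((1 - \sum_(i < n) alpha i) / mu_ P n)).
Proof.
have [L [A [uL uA AL mu0 PE]]] := hermitian_pd_diag hP.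
pose mu (i : 'I_n.+1) := mu_ P i.
have [c1 [c2 [c10 [c20 rhoP]]]] := hrho.
(* The point is completed by its last barycentric coordinate, and the limit becomes one symmetric
   sum. *)
pose al (i : 'I_n.+1) := if unlift ord_max i is Some j then alpha j
  else 1 - \sum_(i < n) alpha i.
have al_lift j : al (lift ord_max j) = alpha j by rewrite /al liftK.
have al_max : al ord_max = 1 - \sum_(i < n) alpha i by rewrite /al unlift_none.
have al0 i : 0 < al i by rewrite /al; case: unlift => [j|]//; rewrite subr_gt0.
have al1 : \sum_i al i = 1.
  rewrite big_ord_lift_max /= al_max; under eq_bigr do rewrite al_lift.
  by rewrite addrC subrK.
have liftE (j : 'I_n) : lift ord_max j = j :> nat by rewrite /= /bump leqNgt ltn_ord.
have -> : \sum_(i < n) alpha i * ln (alpha i / mu_ P i) + (1 - \sum_(i < n) alpha i)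
    * ln ((1 - \sum_(i < n) alpha i) / mu_ P n) = \sum_i al i * ln (al i / mu i).
  rewrite big_ord_lift_max /= al_max; congr (_ + _); apply: eq_bigr => i _.
  by rewrite al_lift /mu liftE.
have alm i : 0 < al i / mu i := divr_gt0 (al0 i) (mu0 i).
pose h k := hexp (m k) (beta k).
have hinv := @cvg_inv_incr R m hm.
have mk k : (k <= m k)%N by elim: k => // k IH; exact: leq_ltn_trans IH (hm k).
have m_near : \forall k \near \oo, (0 < m k)%N.
  near=> k; apply: leq_trans (mk k); near: k; exact: nbhs_infty_ge.
have hcvg i : (h k i)%:R / (m k)%:R @[k --> \oo] --> al i.
  have [j ->|->] := unliftP ord_max i.
    by rewrite al_lift; under eq_cvg do rewrite /h hexp_lift; exact: hconv.
  rewrite al_max.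
  have : 1 - \sum_(i < n) (beta k i : nat)%:R / (m k)%:R @[k --> \oo] -->
      1 - \sum_(i < n) alpha i.
    by apply: cvgB; [exact: cvg_cst|exact: cvg_sumr].
  apply: cvg_trans; apply: near_eq_cvg; near=> k.
  have m0 : (0 < m k)%N by near: k.
  rewrite /h hexp_max natrB// mulrBl divff ?pnatr_eq0 -?lt0n//.
  by rewrite -mulr_suml /mdeg natr_sum.
(* Here [alpha] being interior matters: all homogenized exponents are eventually positive, as the
   upper bound requires. *)
have h_near : \forall k \near \oo, forall i, (0 < h k i)%N.
  apply: filter_forall => i.
  have : \forall k \near \oo, 0 < (h k i)%:R / (m k)%:R :> R.
    by apply: (cvgr_gt _ (hcvg i)).
  apply: filterS => k; case: (h k i) => //; by rewrite mul0r ltxx.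
have [cl [D [cl0 D0 lowP]]] :=
  cheb_norm2_ge uL AL mu0 PE c10 (fun z => (rhoP z).1) al0 al1.
have fs0 z : 0 <= fs_density z :> R.
  rewrite invr_ge0 exprn_ge0// addr_ge0// sumr_ge0// => i _; exact: sqmod_ge0.
have rhoP2 z : 0 <= rho z <= c2 * fs_density z.
  by have [r1 ->] := rhoP z; rewrite andbT (le_trans _ r1)// mulr_ge0// ltW.
pose cu := c2 * (pi ^+ 2) ^+ n.
have cu0 : 0 < cu by rewrite mulr_gt0// !exprn_gt0// pi_gt0.
(* Normalized logarithms of the two norm bounds. The summand with [n.+1] comes from homogenizing to
   degree [m + n.+1]; like the constants and the power of [m], it vanishes in the limit. *)
pose lo k := \sum_i (h k i)%:R / (m k)%:R * ln (al i / mu i)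
  + (m k)%:R^-1 * (ln cl + n.+1%:R * ln (al ord_max / mu ord_max) - n%:R * ln D)
  - (3 * n)%:R * ((m k)%:R^-1 * ln (m k)%:R).
pose up k := \sum_i (h k i)%:R / (m k)%:R * ln ((h k i)%:R / (m k)%:R / mu i)
  + (m k)%:R^-1 * ln cu.
apply: (@squeeze_cvgr _ _ _ _ lo up); last 2 first.
- rewrite -[X in _ --> X]subr0 -[X in _ --> X - 0]addr0.
  apply: cvgB; first apply: cvgD.
  + by apply: cvg_sumr => i; apply: cvgM (hcvg i) _; exact: cvg_cst.
  + rewrite -[X in _ --> X](mul0r (ln cl + n.+1%:R * ln (al ord_max / mu ord_max) - n%:R * ln D)).
    by apply: cvgM hinv _; exact: cvg_cst.
  + rewrite -[X in _ --> X](mulr0 (3 * n)%:R).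
    by apply: cvgM; [exact: cvg_cst|exact: cvg_inv_ln_incr].
- rewrite -[X in _ --> X]addr0; apply: cvgD.
  + apply: cvg_sumr => i; apply: cvgM (hcvg i) _.
    apply: continuous_cvg; first exact: (continuous_ln (alm i)).
    by apply: cvgM (hcvg i) _; exact: cvg_cst.
  + rewrite -[X in _ --> X](mul0r (ln cu)).
    by apply: cvgM hinv _; exact: cvg_cst.
near=> k.
have m0 : (0 < m k)%N by near: k.
have h0 : forall i, (0 < h k i)%N by near: k.
have mR : 0 < (m k)%:R :> R by rewrite ltr0n.
pose lo' := cl * \prod_i (al i / mu i) ^+ hexp (m k + n.+1) (beta k) i / (D * (m k)%:R ^+ 3) ^+ n.
pose up' := cu * \prod_i ((h k i)%:R / (m k)%:R / mu i) ^+ h k i.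
have /andP[lole leup] : lo' <= cheb_norm2 P rho (beta k) <= up'.
  apply: le_fine_ereal_inf.
    by move=> _ [s sb <-]; exact: lowP.
  have [s sb sle] := cheb_norm2_le uA AL mu0 PE (ltW c20) rhoP2 m0 (hbeta k) h0.
  by exists (L2norm2 P rho s) => //; exists s.
have Dm0 : 0 < D * (m k)%:R ^+ 3 by rewrite mulr_gt0// exprn_gt0.
have pr0 : 0 < \prod_i (al i / mu i) ^+ hexp (m k + n.+1) (beta k) i.
  by apply: prodr_gt0 => i _; exact: exprn_gt0.
have lo'0 : 0 < lo' by rewrite divr_gt0 ?mulr_gt0 ?exprn_gt0.
have ch0 := lt_le_trans lo'0 lole.
have up'0 := lt_le_trans ch0 leup.
have hmu i : 0 < (h k i)%:R / (m k)%:R / mu i :> R.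
  by apply: divr_gt0 (mu0 i); apply: divr_gt0 mR; rewrite ltr0n.
have loE : lo k = (m k)%:R^-1 * ln lo'.
  rewrite /lo' ln_div ?posrE ?mulr_gt0 ?exprn_gt0// lnM ?posrE// ln_prodX//.
  rewrite lnXn// -[ln _ *+ n]mulr_natl lnM ?posrE ?exprn_gt0//.
  rewrite lnXn// -[ln _ *+ 3]mulr_natl.
  rewrite big_ord_lift_max /= hexp_max /lo big_ord_lift_max /= /h hexp_max.
  under eq_bigr do rewrite hexp_lift.
  under [in RHS]eq_bigr do rewrite hexp_lift.
  have -> : (m k + n.+1 - mdeg (beta k) = (m k - mdeg (beta k)) + n.+1)%N.
    by rewrite addnC -addnBA// addnC.
  have -> : \sum_(i < n) (beta k i : nat)%:R / (m k)%:R * ln (al (lift ord_max i) / mu (lift ord_max i))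
      = (m k)%:R^-1 * \sum_(i < n) (beta k i : nat)%:R * ln (al (lift ord_max i) / mu (lift ord_max i)).
    by rewrite mulr_sumr; apply: eq_bigr => i _; rewrite mulrCA mulrA.
  by rewrite natrD natrM; ring.
have upE : up k = (m k)%:R^-1 * ln up'.
  rewrite /up' lnM ?posrE//; last by apply: prodr_gt0 => i _; exact: exprn_gt0.
  rewrite ln_prodX// mulrDr addrC; congr (_ + _).
  by rewrite mulr_sumr; apply: eq_bigr => i _; rewrite mulrCA mulrA.
rewrite loE upE !ler_pM2l ?invr_gt0// !ler_ln ?posrE//.
by rewrite lole.
Unshelve. all: by end_near. Qed.
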